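(* For every positive integer $m$, \[ m+(6m)^{1/3}-2<\mathrm{ESO}(m,3)<m+(6m)^{1/3}+3. \] In particular $\mathrm{ESO}(m,3)=m+(6m)^{1/3}+O(1)$.
   Context: For a point $p\in\mathbb{R}^2$ write $x(p),y(p)$ for its coordinates. A finite set of points with distinct $x$-coordinates, listed as $p_1,\dots,p_n$ with $x(p_1)<\dots<x(p_n)$, is an $n$-up-run if $y(p_i)\le y(p_{i+1})$ for all $1\le i\le n-1$, and an $n$-down-run if $y(p_i)>y(p_{i+1})$ for all $1\le i\le n-1$. The Erdős–Szekeres on-line game $A_{m,k}$ ($m,k\ge1$): in each turn, player A chooses a value $\hat x\in(0,1)$ and then player B chooses a value $\hat y\in(0,1)$, forming the point $(\hat x,\hat y)$. The game ends after the first turn at which the set of played points contains an $m$-up-run or a $k$-down-run. Player A aims to end the game in as few turns as possible, player B in as many as possible. $\mathrm{ESO}(m,k)$ denotes the number of turns the game $A_{m,k}$ lasts when both players play optimally. *)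

(* Defs.v *)
From mathcomp Require Import all_boot all_order all_algebra.
From mathcomp Require Import all_classical all_reals all_analysis.

Set Implicit Arguments.
Unset Strict Implicit.
Unset Printing Implicit Defensive.

Import Order.TTheory GRing.Theory Num.Theory.
Import numFieldNormedType.Exports.

Local Open Scope ring_scope.
Local Open Scope classical_set_scope.

Section Game.
Variable R : realType.

(* A run is represented by the sequence of its points in order of increasing
   abscissa; [sorted] compares consecutive points. *)
Definition up_run (n : nat) (s : seq (R * R)) : Prop :=
  [/\ size s = n, sorted (fun p q => p.1 < q.1) s
    & sorted (fun p q => p.2 <= q.2) s].

Definition down_run (n : nat) (s : seq (R * R)) : Prop :=
  [/\ size s = n, sorted (fun p q => p.1 < q.1) s
    & sorted (fun p q => p.2 > q.2) s].

Definition game_over (m k : nat) (h : seq (R * R)) : Prop :=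
  exists s : seq (R * R), {subset s <= h} /\ (up_run m s \/ down_run k s).

(* Strategies depend on the points played so far, in order of play; player B
   moreover sees the abscissa that A has just chosen.  Player A is allowed to
   repeat an abscissa, but points of equal abscissa never share a run. *)
Definition strategyA (a : seq (R * R) -> R) : Prop := forall h, 0 < a h < 1.

Definition strategyB (b : seq (R * R) -> R -> R) : Prop :=
  forall h x, 0 < b h x < 1.

(* The points of the first [n] turns.  The recursion does not stop when the
   game is over: the length of the game is extracted by [lasts]. *)
Fixpoint play (a : seq (R * R) -> R) (b : seq (R * R) -> R -> R) (n : nat) :
    seq (R * R) :=
  if n is n'.+1 then
    let h := play a b n' in rcons h (a h, b h (a h))
  else [::].

Definition lasts (m k : nat) (a : seq (R * R) -> R)
    (b : seq (R * R) -> R -> R) (n : nat) : Prop :=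
  game_over m k (play a b n) /\
  forall i, (i < n)%N -> ~ game_over m k (play a b i).

Definition A_guarantees (m k N : nat) : Prop :=
  exists2 a, strategyA a &
    forall b, strategyB b -> exists2 n, lasts m k a b n & (n <= N)%N.

(* A play that never ends counts in favour of player B. *)
Definition B_guarantees (m k N : nat) : Prop :=
  exists2 b, strategyB b &
    forall a, strategyA a -> forall n, lasts m k a b n -> (N <= n)%N.

Definition game_value (m k N : nat) : Prop :=
  A_guarantees m k N /\ B_guarantees m k N.

Lemma game_value_unique (m k N N' : nat) :
  game_value m k N -> game_value m k N' -> N = N'.
Proof.
have le N1 N2 : A_guarantees m k N1 -> B_guarantees m k N2 -> (N2 <= N1)%N.
  move=> [a sa Ha] [b sb Hb]; have [n ln nN] := Ha b sb.
  exact: leq_trans (Hb a sa n ln) nN.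
by move=> [A B] [A' B']; apply/eqP; rewrite eqn_leq !le.
Qed.

(* The default 0 is never a value when [0 < m] and [0 < k], since the empty set
   contains no nonempty run; so [0 < ESO m k] entails that [ESO m k] is the
   value of the game. *)
Definition ESO (m k : nat) : nat := xget 0%N [set N | game_value m k N].

Lemma ESO_eq (m k N : nat) : game_value m k N -> ESO m k = N.
Proof.
move=> vN; rewrite /ESO; case: xgetP => [n _ vn|/(_ N)//].
exact: game_value_unique vn vN.
Qed.

Lemma ESO_gt0_value (m k : nat) :
  (0 < ESO m k)%N -> game_value m k (ESO m k).
Proof. by rewrite /ESO; case: xgetP. Qed.

End Game.

Arguments ESO R m k : clear implicits.

(* Main.v *)
Require Import Defs.
From mathcomp Require Import all_boot all_order all_algebra.
From mathcomp Require Import all_classical all_reals all_analysis.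
From mathcomp Require Import zify lra.

Set Implicit Arguments.
Unset Strict Implicit.
Unset Printing Implicit Defensive.

Import Order.TTheory GRing.Theory Num.Theory.
Import numFieldNormedType.Exports.

Local Open Scope ring_scope.
Local Open Scope classical_set_scope.

(* Call a turn wasted if it does not lengthen the longest up-run.  While no
   3-down-run exists, each point is the upper or the lower end of inversions, or
   comparable with all other points, and these comparable points form chains
   ("windows") that separate the rest.

   Player A plays in the middle of a window.  If B answers with an inversion
   too close to an end of the window, then A goes on inside the inversion, where
   the points are forced to prolong a run: the wasted turn with [r] others still
   to come must leave at least ['C(r, 2)] points of the window on one side.  So A
   lengthens the window about ['C(r, 2)] times between consecutive wasted turns,
   and [r] turns cannot be wasted before the longest run has about ['C(r, 3)]
   points.

   Player B answers in a window by prolonging it until it has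
   [2 * 'C(r, 2) + 1] points.  Then he puts the new point under the last [r]
   points on the longer side, which costs [r] points of the window.  A turn right
   of the window is answered by the lowest point that creates no 3-down-run and
   lies below the last [r - 1] points of the window; it is again wasted. *)

(** * Up-runs and inversions *)

Section Points.
Variable R : realType.
Implicit Types (p q d : R * R) (s h : seq (R * R)) (m j : nat).

Definition up p q := (p.1 < q.1) && (p.2 <= q.2).

Definition inverted p q := (p.1 < q.1) && (q.2 < p.2).

Lemma up_trans : transitive up.
Proof.
move=> q p d /andP[pq1 pq2] /andP[qd1 qd2].
by rewrite /up (lt_trans pq1) // (le_trans pq2).
Qed.

Lemma up_irr : irreflexive up.
Proof. by move=> p; rewrite /up ltxx. Qed.

Lemma sorted_upE s : sorted up s =
  sorted (fun p q => p.1 < q.1) s && sorted (fun p q => p.2 <= q.2) s.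
Proof. exact: sorted_relI. Qed.

Lemma up_uniq s : sorted up s -> uniq s.
Proof. exact: (sorted_uniq up_trans up_irr). Qed.

Lemma sorted_up_cat s1 s2 : sorted up (s1 ++ s2) =
  [&& sorted up s1, sorted up s2 & allrel up s1 s2].
Proof. by rewrite !(sorted_pairwise up_trans) pairwise_cat andbC -andbA. Qed.

Lemma sorted_up_cons p s : sorted up (p :: s) = all (up p) s && sorted up s.
Proof. by rewrite /= (path_sortedE up_trans). Qed.

Lemma over_up m h s :
  {subset s <= h} -> sorted up s -> (m <= size s)%N -> game_over m 3 h.
Proof.
move=> sh us ms; exists (take m s); split; first by move=> p /mem_take /sh.
left; have := take_sorted m us; rewrite sorted_upE => /andP[s1 s2].
by split => //; rewrite size_takel.
Qed.

Lemma over_down m h p q d : p \in h -> q \in h -> d \in h ->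
  inverted p q -> inverted q d -> game_over m 3 h.
Proof.
move=> ph qh dh /andP[pq1 pq2] /andP[qd1 qd2].
exists [:: p; q; d]; split; first by apply/allP; rewrite /= ph qh dh.
by right; split => //=; rewrite ?pq1 ?qd1 ?pq2 ?qd2.
Qed.

Lemma game_overP m h : game_over m 3 h ->
  (exists2 s, {subset s <= h} & sorted up s /\ size s = m) \/
  (exists p q d, [/\ p \in h, q \in h, d \in h, inverted p q & inverted q d]).
Proof.
move=> [s [sh [[sm s1 s2]|[sm s1 s2]]]].
  by left; exists s => //; rewrite sorted_upE s1 s2.
right; move: s sm s1 s2 sh => [|p [|q [|d [|? ?]]]] //= _.
move=> /and3P[p1 q1 _] /and3P[p2 q2 _] sh; exists p, q, d.
by rewrite /inverted p1 q1 p2 q2 !sh ?inE ?eqxx ?orbT.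
Qed.

(** * Symmetry under the point reflection of the square *)

Definition refl p : R * R := (1 - p.1, 1 - p.2).

Lemma reflK : involutive refl.
Proof. by case=> a b; rewrite /refl /= !subKr. Qed.

Lemma refl_inj : injective refl. Proof. exact: inv_inj reflK. Qed.

Lemma map_reflK : involutive (map refl).
Proof. by move=> s; rewrite mapK //; exact: reflK. Qed.

Lemma mem_refl p s : (refl p \in map refl s) = (p \in s).
Proof. by rewrite mem_map //; exact: refl_inj. Qed.

Lemma mem_refl2 p s : (p \in map refl s) = (refl p \in s).
Proof. by rewrite -{1}[p]reflK mem_refl. Qed.

Lemma up_refl p q : up (refl p) (refl q) = up q p.
Proof. by rewrite /up /= lerD2l ltrD2l ltrN2 lerN2. Qed.

Lemma inverted_refl p q : inverted (refl p) (refl q) = inverted q p.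
Proof. by rewrite /inverted /= !ltrD2l !ltrN2. Qed.

(** Reflection reverses the order of abscissas; [rev] lists the run from left to right again. *)
Definition rrefl s := rev (map refl s).

Lemma rreflK : involutive rrefl.
Proof. by move=> s; rewrite /rrefl map_rev revK map_reflK. Qed.

Lemma mem_rrefl p s : (p \in rrefl s) = (refl p \in s).
Proof. by rewrite mem_rev mem_refl2. Qed.

Lemma size_rrefl s : size (rrefl s) = size s.
Proof. by rewrite size_rev size_map. Qed.

Lemma rrefl_cat s1 s2 : rrefl (s1 ++ s2) = rrefl s2 ++ rrefl s1.
Proof. by rewrite /rrefl map_cat rev_cat. Qed.

Lemma rrefl_cons p s : rrefl (p :: s) = rcons (rrefl s) (refl p).
Proof. by rewrite /rrefl /= rev_cons. Qed.

Lemma rrefl_rcons p s : rrefl (rcons s p) = refl p :: rrefl s.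
Proof. by rewrite /rrefl map_rcons rev_rcons. Qed.

Lemma sorted_rrefl s : sorted up (rrefl s) = sorted up s.
Proof.
rewrite /rrefl rev_sorted sorted_map; apply: eq_sorted => p q.
by rewrite /relpre /= up_refl.
Qed.

Lemma rrefl_sub s h : {subset s <= h} -> {subset rrefl s <= map refl h}.
Proof. by move=> sh p; rewrite mem_rrefl mem_refl2 => /sh. Qed.

Lemma over_refl m h : game_over m 3 h -> game_over m 3 (map refl h).
Proof.
move=> /game_overP[[s sh [us <-]]|[p [q [d [ph qh dh pq qd]]]]].
  by apply: (@over_up _ _ (rrefl s)); rewrite ?sorted_rrefl ?size_rrefl //;
    apply: rrefl_sub.
by apply: (@over_down _ _ (refl d) (refl q) (refl p));
  rewrite ?mem_refl ?inverted_refl.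
Qed.

(* Player A, to move, can end the game [A_{m,3}] within [j] further turns. *)
Fixpoint forced m j h : Prop :=
  game_over m 3 h \/
  if j is j'.+1 then
    exists2 x : R, 0 < x < 1 &
      forall y : R, 0 < y < 1 -> forced m j' (rcons h (x, y))
  else False.

Lemma forced_over m j h : game_over m 3 h -> forced m j h.
Proof. by case: j => [|j]; left. Qed.

(** A plays the mirrored abscissa [1 - x] and reads the answer [y] as [1 - y]. *)
Lemma forced_refl m j h : forced m j h -> forced m j (map refl h).
Proof.
have I (x : R) : (0 < 1 - x < 1) = (0 < x < 1).
  by rewrite subr_gt0 gtrBl andbC.
elim: j h => [|j IH] h [/over_refl|]; [by left| by []| by left|].
move=> [x x01 fx]; right; exists (1 - x); first by rewrite I.
move=> y y01; have := IH _ (fx (1 - y) _); rewrite I => /(_ y01).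
by rewrite map_rcons /refl /= subKr.
Qed.

Lemma forcedS m j h : forced m j h -> forced m j.+1 h.
Proof.
elim: j h => [|j IH] h [ov|]; [by left| by []|exact: forced_over|].
by move=> [x x01 fx]; right; exists x => // y y01; apply: IH; exact: fx.
Qed.

Lemma forced_leq m i j h : (i <= j)%N -> forced m i h -> forced m j h.
Proof.
elim: j => [|j IH]; first by rewrite leqn0 => /eqP->.
by rewrite leq_eqVlt => /predU1P[->//|/IH/[apply]/forcedS].
Qed.

(** * From game trees to strategies and the value of the game *)

Lemma size_play a b n : size (play (R := R) a b n) = n.
Proof. by elim: n => //= n IH; rewrite size_rcons IH. Qed.

Lemma half01 : 0 < (2^-1 : R) < 1.
Proof. by rewrite invr_gt0 ltr0n invf_lt1 ?ltr1n ?ltr0n. Qed.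

(** A picks, by [xget], any abscissa that keeps the position forced; the number of turns left is
    read off the length of the history. The default [2^-1] serves only histories without such an
    abscissa. *)
Lemma forced_guarantee m N : forced m N [::] -> A_guarantees R m 3 N.
Proof.
move=> f0; pose P h (x : R) := 0 < x < 1 /\
  forall y : R, 0 < y < 1 -> forced m (N - (size h).+1) (rcons h (x, y)).
exists (fun h => xget 2^-1 [set x | P h x]).
  by move=> h; case: xgetP => [x _ []//|_]; exact: half01.
set a := (fun h => _) => b sb.
have F n : (n <= N)%N -> (exists2 i, (i <= n)%N & game_over m 3 (play a b i)) \/
    forced m (N - n) (play a b n).
  elim: n => [|n IH] nN; first by right; rewrite subn0.
  have [[i /leqW ? ?]|] := IH (ltnW nN); first by left; exists i.
  rewrite -(subnSK nN) => -[ov|[x x01 fx]]; first by left; exists n.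
  right; rewrite /=; set h := play a b n.
  have : P h (a h).
    rewrite /a; case: xgetP => [//|/(_ x)/= nP].
    by exfalso; apply: nP; split => //; rewrite size_play.
  by rewrite /P size_play => -[_]; apply; exact: sb.
have E : exists i, `[< game_over m 3 (play a b i) >].
  have [[i _ o]|] := F N (leqnn N); first by exists i; apply/asboolP.
  by rewrite subnn => -[ov|//]; exists N; apply/asboolP.
have [i0 i0N o0] : exists2 i, (i <= N)%N & game_over m 3 (play a b i).
  by have [//|] := F N (leqnn N); rewrite subnn => -[ov|//]; exists N.
case: (ex_minnP E) => n /asboolP on nmin; exists n.
  split=> // i lin oi; have := nmin i; rewrite leqNgt lin.
  by move=> /(_ (asboolT oi)).
by apply: leq_trans i0N; apply: nmin; apply/asboolP.
Qed.

(** Dually, B picks a height that keeps the position unforced. No position up to turn [N] is then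
    over, whence [N.+1]. *)
Lemma not_forced_guarantee m N :
  ~ forced m N [::] -> B_guarantees R m 3 N.+1.
Proof.
move=> f0; pose P h (x y : R) := 0 < y < 1 /\
  ~ forced m (N - (size h).+1) (rcons h (x, y)).
exists (fun h x => xget 2^-1 [set y | P h x y]).
  by move=> h x; case: xgetP => [y _ []//|_]; exact: half01.
set b := (fun h x => _) => a sa.
have F n : (n <= N)%N -> ~ forced m (N - n) (play a b n).
  elim: n => [|n IH] nN; first by rewrite subn0.
  move: (IH (ltnW nN)); rewrite -(subnSK nN) => nf /=.
  set h := play a b n in nf *.
  suff : P h (a h) (b h (a h)) by rewrite /P size_play => -[].
  rewrite /b; case: xgetP => [//|nP].
  exfalso; apply: nf; right; exists (a h); first exact: sa.
  move=> y y01; apply: contrapT => ny; apply: (nP y).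
  by rewrite /P size_play.
move=> n [on _]; rewrite ltnNge; apply/negP => /F; apply.
exact: forced_over.
Qed.

(** The value is the least [k] with [forced m k [::]], and [forced] is monotone in the number of
    turns. *)
Lemma ESO_bounds m i j :
  ~ forced m i [::] -> forced m j [::] -> (i < ESO R m 3 <= j)%N.
Proof.
move=> nfi fj.
have E : exists k, `[< forced m k [::] >] by exists j; apply/asboolP.
case: (ex_minnP E) => k /asboolP fk kmin.
have -> : ESO R m 3 = k.
  apply: ESO_eq; split; first exact: forced_guarantee.
  case: k fk kmin => [|k] _ kmin.
    by exists (fun _ _ => 2^-1) => // ? ?; exact: half01.
  apply: not_forced_guarantee => /asboolT/kmin.
  by rewrite ltnn.
rewrite kmin ?andbT; last exact/asboolP.
by rewrite ltnNge; apply/negP => /forced_leq/(_ fk).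
Qed.

(** * Choosing a coordinate between two finite sets *)

Lemma seq_max (x0 : R) (s : seq R) :
  exists2 a, a \in x0 :: s & {in x0 :: s, forall z, z <= a}.
Proof.
elim: s x0 => [|x s IH] x0.
  by exists x0; rewrite ?inE // => z; rewrite inE => /eqP->.
have [a ai am] := IH x; have [ax|/ltW xa] := leP x0 a.
  exists a; first by rewrite in_cons ai orbT.
  by move=> z; rewrite in_cons => /predU1P[->//|/am].
exists x0; first exact: mem_head.
by move=> z; rewrite in_cons => /predU1P[->//|/am/le_trans]; exact.
Qed.

Lemma exists_between (lo hi : seq R) :
  {in lo & hi, forall a b, a < b} -> all (< 1) lo -> all (> 0) hi ->
  exists y, [/\ 0 < y < 1, all (< y) lo & all (> y) hi].
Proof.
move=> lohi /allP/= lo1 /allP/= hi0.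
(* The sides 0 and 1 of the square join the two lists, which also covers empty lists; the minimum of
   [hi] is a negated maximum. *)
have [a ai am] := seq_max 0 lo.
have [b' bi bm] := seq_max (-1) (map -%R hi).
have ab : a < - b'.
  move: ai bi; rewrite !inE => /predU1P[->|ai] /predU1P[->|/mapP[b bi ->]].
  - by rewrite opprK ltr01.
  - by rewrite opprK hi0.
  - by rewrite opprK lo1.
  - by rewrite opprK lohi.
have a0 : 0 <= a by apply: am; rewrite mem_head.
have b1 : - b' <= 1 by rewrite lerNl; apply: bm; rewrite mem_head.
have [y /andP[ay yb]] : exists y, a < y < - b'.
  by exists ((a + - b') / 2); have [-> ->] := midf_lt ab.
exists y; split.
- by rewrite (le_lt_trans a0) // (lt_le_trans yb).
- apply/allP => z zi /=; apply: le_lt_trans ay; apply: am.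
  by rewrite in_cons zi orbT.
- apply/allP => z zi /=; apply: (lt_le_trans yb); rewrite lerNl; apply: bm.
  by rewrite in_cons (map_f -%R zi) orbT.
Qed.

Definition in_square p := (0 < p.1 < 1) && (0 < p.2 < 1).

End Points.

(** * Upper bound: a strategy for player A *)

Section PlayerA.
Variable R : realType.
Implicit Types (x : R) (p q u c d : R * R) (s h W : seq (R * R)) (m j r : nat).

(** * Inversions at the ends of a window *)

Definition under h p := exists2 u, u \in h & inverted u p.

Definition above h p := exists2 d, d \in h & inverted p d.

(** The form with [rcons] makes the condition void for an empty chain, when nothing lies on that
    side of the window; likewise for [first_above]. *)
Definition last_under h s := forall s' p, s = rcons s' p -> under h p.

Definition first_above h s := forall s' p, s = p :: s' -> above h p.

Definition left_of (x : R) s := all (fun p => p.1 < x) s.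

Definition right_of (x : R) s := all (fun p => x < p.1) s.

Lemma last_under_rcons h q s : last_under h s -> last_under (rcons h q) s.
Proof. by move=> D s' p /D[u uh up]; exists u; rewrite // mem_rcons inE uh orbT. Qed.

Lemma first_above_rcons h q s : first_above h s -> first_above (rcons h q) s.
Proof. by move=> U s' p /U[u uh up]; exists u; rewrite // mem_rcons inE uh orbT. Qed.

Lemma all_mem_rcons h q s : all (mem h) s -> all (mem (rcons h q)) s.
Proof.
move=> /allP sh; apply/allP => p /sh /= ph.
by rewrite mem_rcons inE ph orbT.
Qed.

Lemma last_under_refl h s : last_under h s -> first_above (map (@refl R) h) (rrefl s).
Proof.
move=> D s' p /(congr1 (@rrefl R)); rewrite rreflK rrefl_cons => /D[u uh up].
by exists (refl u); rewrite ?mem_refl // -[p]reflK inverted_refl.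
Qed.

Lemma first_above_refl h s : first_above h s -> last_under (map (@refl R) h) (rrefl s).
Proof.
move=> D s' p /(congr1 (@rrefl R)); rewrite rreflK rrefl_rcons => /D[u uh up].
by exists (refl u); rewrite ?mem_refl // -[p]reflK inverted_refl.
Qed.

Lemma left_of_refl x s : left_of x s -> right_of (1 - x) (rrefl s).
Proof.
move=> /allP H; apply/allP => p; rewrite mem_rrefl => /H /=.
by rewrite ltrBlDr -ltrBlDl.
Qed.

Lemma right_of_refl x s : right_of x s -> left_of (1 - x) (rrefl s).
Proof.
move=> /allP H; apply/allP => p; rewrite mem_rrefl => /H /=.
by rewrite ltrBrDr -ltrBrDl.
Qed.

Lemma all_mem_refl h s : all (mem h) s -> all (mem (map (@refl R) h)) (rrefl s).
Proof.
by move=> /allP H; apply/allP => p; rewrite mem_rrefl => /H /=; rewrite mem_refl2.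
Qed.

Lemma refl01 (x : R) : 0 < x < 1 -> 0 < 1 - x < 1.
Proof. by rewrite subr_gt0 gtrBl andbC. Qed.

Lemma in_square_refl h :
  all (@in_square R) h -> all (@in_square R) (map (@refl R) h).
Proof.
move=> /allP H; apply/allP => p; rewrite mem_refl2 => /H /andP[/refl01 + /refl01].
by rewrite /= !subKr /in_square => -> ->.
Qed.

(** This supplies the abscissas of A. The lists need not be chains, so they may include the ends of
    a straddling inversion. *)
Lemma cursor h s1 s2 : all (@in_square R) h -> all (mem h) (s1 ++ s2) ->
  {in s1 & s2, forall p q, p.1 < q.1} ->
  exists x, [/\ 0 < x < 1, left_of x s1 & right_of x s2].
Proof.
rewrite all_cat => /allP hs /andP[/allP s1h /allP s2h] s12.
have [| | |x [x01 x1 x2]] := @exists_between R (map fst s1) (map fst s2).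
- by move=> _ _ /mapP[p /s12 H ->] /mapP[q /H + ->].
- by rewrite all_map; apply/allP => p /s1h /hs /andP[/andP[]].
- by rewrite all_map; apply/allP => p /s2h /hs /andP[/andP[]].
by exists x; move: x1 x2; rewrite !all_map.
Qed.

Lemma left_right_lt x s1 s2 : left_of x s1 -> right_of x s2 ->
  {in s1 & s2, forall p q, p.1 < q.1}.
Proof. by move=> /allP l /allP r p q /l/= px /r/=; exact: lt_trans. Qed.

Lemma sorted_up_insert q s1 s2 : sorted (@up R) (s1 ++ s2) ->
  all (fun p => up p q) s1 -> all (up q) s2 -> sorted (@up R) (s1 ++ q :: s2).
Proof.
rewrite !sorted_up_cat sorted_up_cons => /and3P[-> -> +] s1q ->/=.
by rewrite /allrel => s12; under eq_all do rewrite /=; rewrite all_predI s1q.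
Qed.

Lemma all_up_rcons s p q : sorted (@up R) (rcons s p) -> left_of q.1 (rcons s p) ->
  p.2 <= q.2 -> all (fun p => up p q) (rcons s p).
Proof.
rewrite -cats1 sorted_up_cat => /and3P[_ _ /allrelP sp] /allP sq pq.
apply/allP => z zs; rewrite /up sq //=; move: zs; rewrite mem_cat inE.
by case/orP => [zs|/eqP->//]; have /andP[_ /le_trans] := sp z p zs (mem_head _ _); apply.
Qed.

Lemma all_up_cons s p q : sorted (@up R) (p :: s) -> right_of q.1 (p :: s) ->
  q.2 <= p.2 -> all (up q) (p :: s).
Proof.
rewrite sorted_up_cons => /andP[/allP ps _] /allP sq pq.
apply/allP => z zs; rewrite /up sq //=; move: zs; rewrite inE.
by case/orP => [/eqP->//|/ps /andP[_]]; exact: le_trans.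
Qed.

(* A point below the last point of [s1] or above the first point of [s2]
   completes a 3-down-run. *)
Lemma pinch m h s1 s2 q : q \in h -> all (mem h) (s1 ++ s2) ->
  sorted (@up R) (s1 ++ s2) -> last_under h s1 -> first_above h s2 ->
  left_of q.1 s1 -> right_of q.1 s2 ->
  game_over m 3 h \/
  all (fun p => up p q) s1 && all (up q) s2 && sorted (@up R) (s1 ++ q :: s2).
Proof.
move=> qh; rewrite all_cat => /andP[s1h s2h] us D U l1 r2.
have := us; rewrite sorted_up_cat => /and3P[us1 us2 _].
have [//|s1q] : game_over m 3 h \/ all (fun p => up p q) s1.
  case/lastP: s1 s1h D l1 us1 {us} => [|s1 p] s1h D l1 us1; first by right.
  have [/(all_up_rcons us1 l1)|qp] := leP p.2 q.2; first by right.
  left; have [u uh up] := D _ _ erefl.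
  have ph : p \in h by have /allP := s1h; apply; rewrite mem_rcons mem_head.
  apply: (over_down m uh ph qh up); rewrite /inverted qp andbT.
  by have /allP := l1; apply; rewrite mem_rcons mem_head.
- by left.
have [//|s2q] : game_over m 3 h \/ all (up q) s2.
  case: s2 s2h U r2 us2 {us} => [|p s2] s2h U r2 us2; first by right.
  have [/(all_up_cons us2 r2)|qp] := leP q.2 p.2; first by right.
  left; have [u uh up] := U _ _ erefl.
  have ph : p \in h by have /allP := s2h; apply; rewrite mem_head.
  apply: (over_down m qh ph uh _ up); rewrite /inverted qp andbT.
  by have /allP := r2; apply; rewrite mem_head.
- by left.
by right; rewrite s1q s2q sorted_up_insert.
Qed.

Lemma in_square_rcons h (x y : R) : all (@in_square R) h -> 0 < x < 1 ->
  0 < y < 1 -> all (@in_square R) (rcons h (x, y)).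
Proof. by move=> hs x01 y01; rewrite all_rcons hs /in_square /= x01 y01. Qed.

(* As long as an inversion [u, d] straddles the abscissa played, the new point
   either lies above [u] (then A goes on just to its left) or below [d] (then A
   goes on just to its right): every turn lengthens the run [s1 ++ s2]. *)
Lemma trap_straddled m j h s1 s2 u d x : all (@in_square R) h -> 0 < x < 1 ->
  u \in h -> d \in h -> all (mem h) (s1 ++ s2) -> sorted (@up R) (s1 ++ s2) ->
  last_under h s1 -> first_above h s2 ->
  left_of x (u :: s1) -> right_of x (d :: s2) -> d.2 < u.2 ->
  (m <= size s1 + size s2 + j)%N -> forced m j h.
Proof.
elim: j h s1 s2 u d x => [|j IH] h s1 s2 u d x hs x01 uh dh sh us D U l1 r2 du mj.
  left; apply: (@over_up R m h (s1 ++ s2)) => //; first exact/allP.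
  by rewrite size_cat -[X in (_ <= X)%N]addn0.
right; exists x => // y y01; set q := (x, y); set h' := rcons h q.
have hs' : all (@in_square R) h' by exact: in_square_rcons.
have qh' : q \in h' by rewrite mem_rcons mem_head.
have uh' : u \in h' by rewrite mem_rcons inE uh orbT.
have dh' : d \in h' by rewrite mem_rcons inE dh orbT.
have sh' := all_mem_rcons q sh.
have D' := last_under_rcons q D; have U' := first_above_rcons q U.
have /andP[ux l1s] := l1; have /andP[dx r2s] := r2.
have [/forced_over//|/andP[/andP[s1q qs2] us']] :=
  pinch m qh' sh' us D' U' l1s r2s.
have sqh' : all (mem h') (s1 ++ q :: s2).
  by move: sh'; rewrite !all_cat /= qh'.
have [uy|yu] := leP u.2 y.
  have [||x' [x'01 l' r']] := @cursor h' (u :: s1) (d :: q :: s2) hs'.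
  - by move: sqh'; rewrite /= uh' !all_cat /= dh'.
  - have r2' : right_of x s2 by [].
    move=> a b aL; rewrite !inE => /or3P[/eqP->|/eqP->|bR].
    + by apply: (left_right_lt l1 r2) => //; exact: mem_head.
    + by have /allP := l1; exact.
    + exact: (left_right_lt l1 r2s).
  apply: (IH h' s1 (q :: s2) u d x') => //.
  - by move=> s' p [<- _]; exists d; rewrite // /inverted dx (lt_le_trans du).
  - by rewrite /= addnS addSn -addnS.
have [yd|dy] := leP y d.2; last first.
  apply/forced_over/(@over_down _ _ _ u q d) => //.
    by rewrite /inverted ux.
  by rewrite /inverted dx.
have [||x' [x'01 l' r']] := @cursor h' (u :: rcons s1 q) (d :: s2) hs'.
- by move: sqh'; rewrite /= uh' cat_rcons !all_cat /= dh'.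
- move=> a b; rewrite inE mem_rcons inE => /or3P[/eqP->|/eqP->|aL] bR.
  + by apply: (left_right_lt l1 r2) => //; exact: mem_head.
  + by have /allP := r2; exact.
  + exact: (left_right_lt l1s r2).
apply: (IH h' (rcons s1 q) s2 u d x') => //; rewrite ?cat_rcons //.
- move=> s' p /rcons_inj[_ <-]; exists u => //.
  by rewrite /inverted ux (le_lt_trans yd).
- by move: mj; rewrite size_rcons; clear; lia.
Qed.

(** * Traps: windows next to an inversion *)

Lemma sorted_up_split y W : sorted (@up R) W -> exists W1 W2,
  [/\ W = W1 ++ W2, all (fun p => p.2 <= y) W1 & all (fun p => y < p.2) W2].
Proof.
elim: W => [|p W IH]; first by exists [::], [::].
rewrite sorted_up_cons => /andP[/allP pW /IH[W1 [W2 [WE W1y yW2]]]].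
have [py|yp] := leP p.2 y.
  by exists (p :: W1), W2; rewrite WE /= py.
exists [::], (p :: W); split => //=; rewrite yp; apply/allP => z /pW /andP[_].
exact: lt_le_trans.
Qed.

Lemma sorted_up_mid s1 s2 s3 : sorted (@up R) (s1 ++ s2 ++ s3) ->
  sorted (@up R) (s1 ++ s3).
Proof.
apply: subseq_sorted; first exact: up_trans.
by rewrite cat_subseq ?subseq_refl ?suffix_subseq.
Qed.

Lemma first_above_inverted h q s s2 : q \in h -> s != [::] ->
  all (fun p => inverted p q) s -> first_above h (s ++ s2).
Proof.
by case: s => // p s qh _ /= /andP[pq _] s' p' [<- _]; exists q.
Qed.

(** The triangular number [1 + ... + r]. The step from [Theta r.+1] down to [Theta r] is [r.+1], the
    least loss of the window at a wasted turn in [trap_window]. *)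
Definition Theta r := 'C(r.+1, 2).

Lemma ThetaS r : Theta r.+1 = (Theta r + r.+1)%N.
Proof. by rewrite /Theta binS bin1. Qed.

Lemma sorted_up_lt1 s1 s2 : sorted (@up R) (s1 ++ s2) ->
  {in s1 & s2, forall p q, p.1 < q.1}.
Proof.
rewrite sorted_up_cat => /and3P[_ _ /allrelP H] p q ps qs.
by have /andP[] := H p q ps qs.
Qed.

(* When the answer lies below the last [k] points of [W], going on to its right
   costs A at most [k] turns.  If that is too much, then A goes on just to the
   right of the first of these [k] points, with at least [r] fewer points in the
   window and one wasted turn of B fewer to allow for. *)
Lemma trap_window m r j h s1 W c s2 d x : all (@in_square R) h -> 0 < x < 1 ->
  d \in h -> all (mem h) (s1 ++ W ++ c :: s2) ->
  sorted (@up R) (s1 ++ W ++ c :: s2) ->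
  last_under h s1 -> first_above h s2 ->
  left_of x (s1 ++ rcons W c) -> right_of x (d :: s2) -> d.2 < c.2 ->
  (m + r <= size s1 + size W + size s2 + j.+1)%N -> (size W < Theta r)%N ->
  forced m j h.
Proof.
elim: j r h s1 W c s2 d x => [|j IH] r h s1 W c s2 d x hs x01 dh sh us D U l1 r2
    dc mj Wr.
  left; apply: (@over_up R m h (s1 ++ W ++ c :: s2)) => //; first exact/allP.
  by move: mj; rewrite !size_cat /=; clear; lia.
case: r mj Wr => [|r] mj Wr; first by rewrite /Theta bin_small in Wr.
right; exists x => // y y01; set q := (x, y); set h' := rcons h q.
have hs' : all (@in_square R) h' by exact: in_square_rcons.
have qh' : q \in h' by rewrite mem_rcons mem_head.
have dh' : d \in h' by rewrite mem_rcons inE dh orbT.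
have sh' := all_mem_rcons q sh; rewrite -/h' in sh'.
have D' := last_under_rcons q D; have U' := first_above_rcons q U.
have := l1; rewrite /left_of all_cat all_rcons => /and3P[l1s cx l1W].
have /andP[dx r2s] := r2.
have := sh'; rewrite !all_cat => /= /and4P[s1h' Wh' ch' s2h'].
have us12 : sorted (@up R) (s1 ++ s2).
  by apply: (@sorted_up_mid _ (rcons W c)); rewrite cat_rcons.
have [|/forced_over//|/andP[/andP[s1q qs2] us']] :=
  pinch m qh' _ us12 D' U' l1s r2s; first by rewrite all_cat s1h'.
have [cy|yc] := leP c.2 y.
  have uq : sorted (@up R) (s1 ++ W ++ c :: q :: s2).
    have E s : s1 ++ W ++ c :: s = rcons (s1 ++ W) c ++ s.
      by rewrite cat_rcons catA.
    rewrite E; rewrite E in us; apply: sorted_up_insert => //.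
    apply: all_up_rcons => //; last by rewrite rcons_cat.
    by move: us; rewrite sorted_up_cat => /and3P[].
  have [||x' [x'01 l' r']] := @cursor h' (s1 ++ rcons W c) (d :: q :: s2) hs'.
  - by rewrite !all_cat all_rcons /= s1h' Wh' ch' dh' qh'.
  - move=> a b aL; rewrite !inE => /or3P[/eqP->|/eqP->|bR].
    + by apply: (left_right_lt l1 r2) => //; exact: mem_head.
    + by have /allP := l1; exact.
    + exact: (left_right_lt l1 r2s).
  apply: (IH r.+1 h' s1 W c (q :: s2) d x') => //.
  - by rewrite !all_cat /= s1h' Wh' ch' qh'.
  - by move=> s' p [<- _]; exists d; rewrite // /inverted dx (lt_le_trans dc).
  - by move: mj => /=; clear; lia.
have [yd|dy] := leP y d.2; last first.
  apply/forced_over/(@over_down _ _ _ c q d) => //.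
    by rewrite /inverted cx.
  by rewrite /inverted dx.
have [|W1 [W2 [WE W1y yW2]]] := @sorted_up_split y W.
  by move: us; rewrite !sorted_up_cat => /and3P[_ /and3P[]].
move: l1W Wh'; rewrite WE !all_cat => /andP[l1W1 l1W2] /andP[W1h' W2h'].
have cq : inverted c q by rewrite /inverted cx yc.
(* Trading [W2] and [c] for [q] shortens the run by [size W2]. With the turn itself this costs at
   most the [r.+1] turns that may be wasted; from now on [c] and [d] straddle the cursor. *)
have [W2r|rW2] := leqP (size W2) r.
  have uq : sorted (@up R) (s1 ++ W1 ++ q :: s2).
    rewrite catA; apply: sorted_up_insert => //.
      apply: (@sorted_up_mid _ (rcons W2 c)).
      by move: us; rewrite WE cat_rcons -!catA.
    rewrite all_cat s1q; apply/allP => z zW; rewrite /up.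
    by move: (allP l1W1 _ zW) (allP W1y _ zW) => /= -> ->.
  have [||x' [x'01 l' r']] := @cursor h' (c :: s1 ++ rcons W1 q) (d :: s2) hs'.
  - by rewrite /= ch' !all_cat all_rcons /= s1h' W1h' dh' qh'.
  - move=> a b; rewrite inE mem_cat mem_rcons inE.
    case/or4P => [/eqP->|aL|/eqP->|aL] bR.
    + by have /allP/(_ b bR) := r2; exact: lt_trans.
    + exact: (left_right_lt l1s r2).
    + by have /allP := r2; exact.
    + exact: (left_right_lt l1W1 r2).
  apply: (@trap_straddled m j h' (s1 ++ rcons W1 q) s2 c d x') => //.
  - by rewrite !all_cat all_rcons /= s1h' W1h' qh' s2h'.
  - by rewrite -catA cat_rcons.
  - move=> s' p; rewrite -rcons_cat => /rcons_inj[_ <-].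
    by exists c.
  - by move: mj W2r; rewrite WE !size_cat size_rcons; clear; lia.
(* At least [r.+1] points leave the window: the first, [c'], forms the new straddling inversion with
   [q]; the others and [c] lie above [q] and pass to the right side. *)
case: W2 => [|c' W2] // in WE yW2 l1W2 W2h' rW2 *.
move: us; rewrite WE -!catA cat_cons => us.
have usL : sorted (@up R) ((s1 ++ rcons W1 c') ++ (rcons W2 c ++ s2)).
  by rewrite !cat_rcons -!catA cat_rcons.
move: yW2 l1W2 W2h' => /= /andP[yc' yW2] /andP[l1c' l1W2] /andP[c'h' W2h'].
have [||x' [x'01 l' r']] :=
    @cursor h' (s1 ++ rcons W1 c') (q :: rcons W2 c ++ s2) hs'.
- by rewrite !all_cat all_rcons /= cat_rcons !all_cat /= s1h' W1h' c'h' qh' W2h' ch'.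
- move=> a b aL; rewrite inE => /predU1P[->|]; last exact: (sorted_up_lt1 usL).
  move: aL; rewrite mem_cat mem_rcons inE => /or3P[aL|/eqP->//|aL].
  + by have /allP := l1s; exact.
  + by have /allP := l1W1; exact.
apply: (IH r h' s1 W1 c' (rcons W2 c ++ s2) q x') => //.
- by rewrite ?cat_rcons !all_cat /= !all_cat /= s1h' W1h' c'h' W2h' ch'.
- by rewrite cat_rcons.
- apply: (first_above_inverted qh'); first by case: (W2).
  rewrite all_rcons cq; apply/allP => z zW; rewrite /inverted.
  by move: (allP l1W2 _ zW) (allP yW2 _ zW) => /= -> ->.
- by move: mj; rewrite WE !size_cat /= size_rcons; clear; lia.
- by move: Wr rW2; rewrite WE size_cat ThetaS /=; clear; lia.
Qed.

(** Mirror image of [trap_window]: the chain passes through the lower end [c] of the inversion, with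
    the window to the right of it. *)
Lemma trap_window_refl m r j h s1 W c s2 u x : all (@in_square R) h ->
  0 < x < 1 -> u \in h -> all (mem h) (s1 ++ c :: W ++ s2) ->
  sorted (@up R) (s1 ++ c :: W ++ s2) ->
  last_under h s1 -> first_above h s2 ->
  left_of x (u :: s1) -> right_of x (c :: W ++ s2) -> c.2 < u.2 ->
  (m + r <= size s1 + size W + size s2 + j.+1)%N -> (size W < Theta r)%N ->
  forced m j h.
Proof.
move=> hs x01 uh sh us D U l1 r2 cu mj Wr.
rewrite -[h](@map_reflK R); apply: forced_refl.
apply: (@trap_window m r j _ (rrefl s2) (rrefl W) (refl c) (rrefl s1) (refl u)
  (1 - x)).
- exact: in_square_refl.
- exact: refl01.
- by rewrite mem_refl.
- rewrite -cat_rcons -rrefl_cons catA -!rrefl_cat; apply: all_mem_refl.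
  by rewrite cat_cons.
- by rewrite -cat_rcons -rrefl_cons catA -!rrefl_cat sorted_rrefl cat_cons.
- exact: first_above_refl.
- exact: last_under_refl.
- rewrite -rrefl_cons -rrefl_cat; apply: right_of_refl.
  by rewrite cat_cons.
- rewrite /right_of /=; have /andP[ux /left_of_refl l1s] := l1.
  by rewrite ltrD2l ltrN2 ux.
- by rewrite /= ltrD2l ltrN2.
- by rewrite !size_rrefl; move: mj; clear; lia.
- by rewrite size_rrefl.
Qed.

(* The answer [q] to the turn between [c] and [d] in [trap_pair], when it does
   not lie above [c]; the other case follows by reflection. *)
Lemma trap_pair_low m r j h s1 W1 c d W2 s2 q : all (@in_square R) h ->
  q \in h -> d \in h -> all (mem h) (s1 ++ W1 ++ c :: W2 ++ s2) ->
  sorted (@up R) (s1 ++ W1 ++ c :: W2 ++ s2) ->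
  sorted (@up R) (s1 ++ W1 ++ d :: W2 ++ s2) ->
  last_under h s1 -> first_above h s2 ->
  left_of q.1 (s1 ++ rcons W1 c) -> right_of q.1 (d :: W2 ++ s2) ->
  d.2 < c.2 -> q.2 <= d.2 -> all (fun p => up p q) s1 ->
  (m + r.+1 <= size s1 + size W1 + size W2 + size s2 + j.+2)%N ->
  (size W1 <= Theta r)%N -> (size W2 < Theta r.+1)%N ->
  forced m j h.
Proof.
move=> hs qh dh sh usc usd D U l1 r2 dc qd s1q mj W1r W2r.
have := sh; rewrite !all_cat /= all_cat => /and5P[s1h W1h ch W2h s2h].
have := l1; rewrite /left_of all_cat all_rcons => /and3P[l1s cx l1W].
have := r2; rewrite /right_of /= all_cat => /and3P[dx r2W r2s].
have cq : inverted c q by rewrite /inverted cx (le_lt_trans qd).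
have [|Wa [Wb [WE Way yWb]]] := @sorted_up_split q.2 W1.
  by move: usc; rewrite !sorted_up_cat => /and3P[_ /and3P[]].
have s1qW : all (fun p => up p q) (s1 ++ Wa).
  rewrite all_cat s1q; apply/allP => z zW; rewrite /up.
  have -> : z.1 < q.1.
    by have /allP := l1W; apply; rewrite WE mem_cat zW.
  exact: (allP Way).
(* If [q] is above all of [W1], then it lengthens the chain through [d] and no turn is wasted.
   Otherwise one turn is wasted and [W1] shrinks. *)
case: Wb WE yWb => [|c' Wb].
  rewrite cats0 => WE _; rewrite -WE in s1qW.
  have [||x' [x'01 l' r']] :=
      @cursor h (c :: s1 ++ rcons W1 q) (d :: W2 ++ s2) hs.
- by rewrite /= !all_cat /= !all_cat !all_rcons /= ch s1h W1h qh dh W2h.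
  - move=> a b aL bR; have /allP/(_ b bR)/= qb := r2; apply: le_lt_trans qb.
    move: aL; rewrite inE mem_cat mem_rcons inE.
    case/or4P => [/eqP->|aL|/eqP->//|aL].
    + exact: ltW.
    + by have /allP/(_ a aL)/ltW := l1s.
    + by have /allP/(_ a aL)/ltW := l1W.
  apply: (@trap_window_refl m r.+1 j h (s1 ++ rcons W1 q) W2 d s2 c x') => //.
  - by rewrite !all_cat all_rcons /= all_cat s1h W1h qh dh W2h.
  - rewrite -cats1 catA -catA; apply: sorted_up_insert => //.
      by rewrite -catA.
    rewrite /up /= dx qd /=; apply/allP => z zW.
    have -> /= : q.1 < z.1 by have /allP := r2; apply; rewrite inE zW orbT.
    apply: (le_trans qd); move: usd; rewrite !sorted_up_cat.
    case/and3P => _ /and3P[_ + _] _; rewrite sorted_up_cons => /andP[/allP H _].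
    by have /andP[] := H z zW.
  - by move=> s' p; rewrite -rcons_cat => /rcons_inj[_ <-]; exists c.
  - by move: mj; rewrite size_cat size_rcons; clear; lia.
move=> WE /= /andP[yc' yWb].
have [usL us'] : sorted (@up R) ((s1 ++ rcons Wa c') ++ (rcons Wb c ++ W2 ++ s2)) /\
    all (mem h) (s1 ++ Wa ++ c' :: rcons Wb c ++ W2 ++ s2).
  move: usc sh; rewrite WE.
  have -> : s1 ++ (Wa ++ c' :: Wb) ++ c :: W2 ++ s2 =
            s1 ++ Wa ++ c' :: rcons Wb c ++ W2 ++ s2.
    by rewrite cat_rcons -catA.
  by move=> usc' sh'; split => //; rewrite -catA cat_rcons.
have l1Wb : all (fun p => p.1 < q.1) (c' :: Wb).
  by move: l1W; rewrite WE all_cat => /andP[].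
have [||x' [x'01 l' r']] :=
    @cursor h (s1 ++ rcons Wa c') (q :: rcons Wb c ++ W2 ++ s2) hs.
- by move: us'; rewrite -cat_rcons catA all_cat => /andP[E1 E2]; rewrite all_cat /= E1 qh E2.
- move=> a b aL; rewrite inE => /predU1P[->|]; last exact: (sorted_up_lt1 usL).
  move: aL; rewrite mem_cat mem_rcons inE => /or3P[aL|/eqP->|aL].
  + by have /allP := l1s; exact.
  + by have /andP[] := l1Wb.
  + by have /allP := l1W; apply; rewrite WE mem_cat aL.
apply: (@trap_window m r j h s1 Wa c' (rcons Wb c ++ W2 ++ s2) q x') => //.
- by rewrite -cat_rcons catA.
- apply: (first_above_inverted qh); first by case: (Wb).
  rewrite all_rcons cq; apply/allP => z zW; rewrite /inverted.
  have -> : z.1 < q.1 by have /andP[_ /allP] := l1Wb; apply.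
  exact: (allP yWb).
- by move: mj; rewrite WE !size_cat /= size_rcons; clear; lia.
- by move: W1r; rewrite WE size_cat /=; clear; lia.
Qed.

Lemma Theta_leS r : (Theta r < Theta r.+1)%N.
Proof. by rewrite ThetaS; clear; lia. Qed.

(** The chains through [c] and through [d] are equally long. A plays between these points: an answer
    between their heights completes a 3-down-run, and the cases below [d] and above [c] are mirror
    images. *)
Lemma trap_pair m r j h s1 W1 c d W2 s2 x : all (@in_square R) h ->
  0 < x < 1 -> d \in h -> all (mem h) (s1 ++ W1 ++ c :: W2 ++ s2) ->
  sorted (@up R) (s1 ++ W1 ++ c :: W2 ++ s2) ->
  sorted (@up R) (s1 ++ W1 ++ d :: W2 ++ s2) ->
  last_under h s1 -> first_above h s2 ->
  left_of x (s1 ++ rcons W1 c) -> right_of x (d :: W2 ++ s2) ->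
  d.2 < c.2 -> (m + r.+1 <= size s1 + size W1 + size W2 + size s2 + j.+1)%N ->
  (size W1 <= Theta r)%N -> (size W2 <= Theta r)%N -> forced m j h.
Proof.
move=> hs x01 dh sh usc usd D U l1 r2 dc mj W1r W2r.
have Tr := Theta_leS r.
case: j => [|j] in mj *.
  left; apply: (over_up _ usc); first exact/allP.
  by move: mj; rewrite !size_cat /= size_cat; clear; lia.
right; exists x => // y y01; set q := (x, y); set h' := rcons h q.
have hs' : all (@in_square R) h' by exact: in_square_rcons.
have qh' : q \in h' by rewrite mem_rcons mem_head.
have dh' : d \in h' by rewrite mem_rcons inE dh orbT.
have sh' := all_mem_rcons q sh; rewrite -/h' in sh'.
have D' := last_under_rcons q D; have U' := first_above_rcons q U.
have := l1; rewrite /left_of all_cat all_rcons => /and3P[l1s cx l1W].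
have := r2; rewrite /right_of /= all_cat => /and3P[dx r2W r2s].
have := sh'; rewrite !all_cat /= all_cat => /and5P[s1h' W1h' ch' W2h' s2h'].
have us12 : sorted (@up R) (s1 ++ s2).
  by apply: (@sorted_up_mid _ (W1 ++ c :: W2)); rewrite -catA.
have [|/forced_over//|/andP[/andP[s1q qs2] us']] :=
  pinch m qh' _ us12 D' U' l1s r2s; first by rewrite all_cat s1h'.
have [yd|dy] := leP y d.2.
  apply: (@trap_pair_low m r j h' s1 W1 c d W2 s2 q) => //.
  exact: leq_ltn_trans Tr.
have [cy|yc] := leP c.2 y; last first.
  apply/forced_over/(@over_down _ _ _ c q d) => //.
    by rewrite /inverted cx.
  by rewrite /inverted dx.
rewrite -[h'](@map_reflK R); apply: forced_refl.
have Erefl e : rrefl s2 ++ rrefl W2 ++ refl e :: rrefl W1 ++ rrefl s1 =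
    rrefl (s1 ++ W1 ++ e :: W2 ++ s2).
  by rewrite -cat_rcons -rrefl_cons catA -!rrefl_cat cat_cons !catA.
apply: (@trap_pair_low m r j _ (rrefl s2) (rrefl W2) (refl d) (refl c)
  (rrefl W1) (rrefl s1) (refl q)).
- exact: in_square_refl.
- by rewrite mem_refl.
- by rewrite mem_refl.
- rewrite Erefl; apply: all_mem_refl.
  by rewrite !all_cat /= all_cat s1h' W1h' dh' W2h'.
- by rewrite Erefl sorted_rrefl.
- by rewrite Erefl sorted_rrefl.
- exact: first_above_refl.
- exact: last_under_refl.
- rewrite -rrefl_cons -rrefl_cat; apply: right_of_refl.
  by rewrite cat_cons.
- rewrite /right_of /= ltrD2l ltrN2 cx /= -rrefl_cat; apply: left_of_refl.
  by rewrite /left_of all_cat l1s.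
- by rewrite /= ltrD2l ltrN2.
- by rewrite /= lerD2l lerN2.
- apply/allP => z; rewrite mem_rrefl => zs2; rewrite -[z](@reflK R) up_refl.
  by have /allP := qs2; apply.
- by rewrite !size_rrefl; move: mj; clear; lia.
- by rewrite size_rrefl.
- by rewrite size_rrefl; exact: leq_ltn_trans Tr.
Qed.

(* The answer [q] of B in [window_win] lies below some points of the left half.
   The hypothesis on all windows is the induction hypothesis of [window_win]. *)
Lemma window_low m r j h s1 Wa Wb W2 s2 q : all (@in_square R) h ->
  (forall W s2', all (mem h) (s1 ++ W ++ s2') ->
     sorted (@up R) (s1 ++ W ++ s2') -> first_above h s2' ->
     (m + r <= size (s1 ++ W ++ s2') + j)%N ->
     (m <= size (s1 ++ W ++ s2') + ('C(r, 3) - size W))%N -> forced m j h) ->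
  q \in h -> all (mem h) (s1 ++ Wa ++ Wb ++ W2 ++ s2) ->
  sorted (@up R) (s1 ++ Wa ++ Wb ++ W2 ++ s2) ->
  last_under h s1 -> first_above h s2 ->
  left_of q.1 (s1 ++ Wa ++ Wb) -> right_of q.1 (W2 ++ s2) ->
  all (fun p => up p q) (s1 ++ Wa) -> all (fun p => q.2 < p.2) Wb ->
  (0 < size Wb)%N ->
  (size Wa + size Wb <= (size W2).+1)%N -> (size W2 <= (size Wa + size Wb).+1)%N ->
  (m + r <= size (s1 ++ Wa ++ Wb ++ W2 ++ s2) + j)%N ->
  (m <= size (s1 ++ Wa ++ Wb ++ W2 ++ s2)
        + ('C(r.+1, 3) - (size Wa + size Wb + size W2)))%N ->
  forced m j h.
Proof.
move=> hs IH qh sh us D U l1 r2 saq yWb Wb0 ba1 ba2 mj mB.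
have qWb : all (fun p => inverted p q) Wb.
  apply/allP => z zW; rewrite /inverted; move: (allP yWb _ zW) => /= ->.
  by rewrite andbT; apply: (allP l1); rewrite !mem_cat zW !orbT.
have Ub s : first_above h (Wb ++ s).
  by apply: (first_above_inverted qh); [case: (Wb) Wb0|].
(* A large window loses at least ['C(r, 2)] points to the right side, which is
   ['C(r.+1, 3) - 'C(r, 3)], so [Wa] is a window fit for [r]. A small one is left to the traps. *)
have [W2K|KW2] := leqP (2 * 'C(r, 2)) (size Wa + size Wb + size W2).
  apply: (IH Wa (Wb ++ W2 ++ s2)) => //.
  by move: mB Wb0 ba1 ba2 W2K; rewrite binS; clear; lia.
have r2' : (1 < r)%N.
  by rewrite ltnNge; apply/negP => r1; move: KW2; rewrite bin_small // muln0.
case: r => [//|r] in IH mj mB r2' KW2 *.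
have KT : 'C(r.+1, 2) = Theta r by [].
have := Theta_leS r.
case: Wb => [//|c Wb] in yWb Wb0 ba1 ba2 sh us l1 qWb Ub mB KW2 mj *.
have := sh; rewrite !all_cat /= => /and4P[s1h Wah /andP[ch Wbh] /andP[W2h s2h]].
have := l1; rewrite /left_of !all_cat /= => /and4P[l1s l1a cx l1b].
have := r2; rewrite /right_of all_cat => /andP[r2W r2s].
have usL : sorted (@up R) ((s1 ++ rcons Wa c) ++ (Wb ++ W2 ++ s2)).
  by rewrite -catA cat_rcons.
have [cq qc] : inverted c q /\ q.2 < c.2.
  by move: qWb => /= /andP[]; rewrite /inverted => /andP[-> ->].
move=> Tr.
have [||x' [x'01 l' r']] :=
    @cursor h (s1 ++ rcons Wa c) (q :: Wb ++ W2 ++ s2) hs.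
- by rewrite !all_cat all_rcons /= !all_cat s1h Wah ch qh Wbh W2h.
- move=> a b aL; rewrite inE => /predU1P[->|].
    move: aL; rewrite mem_cat mem_rcons inE => /or3P[aL|/eqP->//|aL].
    + by have /allP := l1s; exact.
    + by have /allP := l1a; exact.
  exact: (sorted_up_lt1 usL).
(* If [c] is the only point of the left half above [q], no other point of it is left to open the
   right side; but then [c] and [q] are interchangeable in the chain and [trap_pair] applies. *)
case: (posnP (size Wb)) => [/size0nil Wb_nil|Wb1]; last first.
  apply: (@trap_window m r.+1 j h s1 Wa c (Wb ++ W2 ++ s2) q x') => //.
  - apply: (first_above_inverted qh); first by case: (Wb) Wb1.
    by move: qWb => /= /andP[].
  - by move: mj; rewrite !size_cat /= ?size_cat; clear; lia.
  - by move: ba1 ba2 KW2 Tr; rewrite KT /=; clear; lia.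
move: us sh r' mj ba1 ba2 KW2 mB Ub; rewrite {}Wb_nil /= => us sh r' mj ba1 ba2 KW2 mB Ub.
apply: (@trap_pair m r j h s1 Wa c q W2 s2 x') => //.
- rewrite catA; apply: sorted_up_insert.
  + by apply: (@sorted_up_mid _ [:: c]); rewrite -catA.
  + by [].
  + apply/allP => z zR; rewrite /up (allP r2 z zR) /= (le_trans (ltW qc)) //.
    move: us; rewrite !sorted_up_cat sorted_up_cons.
    by case/and3P => _ /and3P[_ /andP[/allP/(_ z zR)/andP[]]].
- by move: mj; rewrite !size_cat /= ?size_cat; clear; lia.
- by move: ba1 ba2 KW2 Tr; rewrite KT /=; clear; lia.
- by move: ba1 ba2 KW2 Tr; rewrite KT /=; clear; lia.
Qed.

(** * The strategy of A: turns in the middle of the window *)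

Lemma all_le_rrefl s (y : R) : all (fun p => p.2 <= 1 - y) (rrefl s) ->
  all (fun p => y <= p.2) s.
Proof.
move=> /allP H; apply/allP => p ps; have := H (refl p).
by rewrite mem_rrefl reflK => /(_ ps) /=; rewrite lerD2l lerN2.
Qed.

(** Invariant: [r] turns may still be wasted, and the run lacks at most ['C(r, 3) - size W] points.
    An answer that prolongs the window keeps both bounds; any other is left to [window_low] or its
    mirror image. *)
Lemma window_win m r j h s1 W s2 : all (@in_square R) h ->
  all (mem h) (s1 ++ W ++ s2) -> sorted (@up R) (s1 ++ W ++ s2) ->
  last_under h s1 -> first_above h s2 ->
  (m + r <= size (s1 ++ W ++ s2) + j)%N ->
  (m <= size (s1 ++ W ++ s2) + ('C(r, 3) - size W))%N -> forced m j h.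
Proof.
elim: j r h s1 W s2 => [|j IH] r h s1 W s2 hs sh us D U mj mB.
  left; apply: (over_up _ us); first exact/allP.
  by move: mj; clear; lia.
have [mL|Lm] := leqP m (size (s1 ++ W ++ s2)).
  by apply/forced_over/(over_up _ us) => //; exact/allP.
case: r mj mB => [|r] mj mB.
  by exfalso; move: mB Lm; rewrite bin_small // leqNgt; clear; lia.
pose Wl := take (size W)./2 W; pose Wr := drop (size W)./2 W.
have WE : W = Wl ++ Wr by rewrite cat_take_drop.
have sWl : size Wl = (size W)./2.
  by rewrite size_takel //; clear; lia.
have sWr : size Wr = (size W - (size W)./2)%N by rewrite size_drop.
have sW : size W = (size Wl + size Wr)%N by rewrite WE size_cat.
have [bal1 bal2] : (size Wl <= (size Wr).+1 /\ size Wr <= (size Wl).+1)%N.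
  by rewrite sWl sWr; clear; split; lia.
have usL : sorted (@up R) ((s1 ++ Wl) ++ (Wr ++ s2)).
  by move: us; rewrite WE -!catA.
have [||x [x01 l1 r2]] := @cursor h (s1 ++ Wl) (Wr ++ s2) hs.
- by move: sh; rewrite WE -!catA.
- exact: sorted_up_lt1 usL.
right; exists x => // y y01; set q := (x, y); set h' := rcons h q.
have hs' : all (@in_square R) h' by exact: in_square_rcons.
have qh' : q \in h' by rewrite mem_rcons mem_head.
have sh' := all_mem_rcons q sh; rewrite -/h' in sh'.
have D' := last_under_rcons q D; have U' := first_above_rcons q U.
have := l1; rewrite /left_of all_cat => /andP[l1s l1W].
have := r2; rewrite /right_of all_cat => /andP[r2W r2s].
have := sh'; rewrite WE !all_cat => /and3P[s1h' /andP[Wlh' Wrh'] s2h'].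
have us12 := sorted_up_mid us.
have [|/forced_over//|/andP[/andP[s1q qs2] us']] :=
  pinch m qh' _ us12 D' U' l1s r2s; first by rewrite all_cat s1h'.
have uWl : sorted (@up R) Wl by move: usL; rewrite !sorted_up_cat => /and3P[/and3P[]].
have uWr : sorted (@up R) Wr by move: usL; rewrite !sorted_up_cat => /and3P[_ /and3P[]].
have [Wa [Wb [WlE Way yWb]]] := sorted_up_split y uWl.
have saq : all (fun p => up p q) (s1 ++ Wa).
  rewrite all_cat s1q; apply/allP => z zW; rewrite /up (allP Way z zW) andbT.
  by apply: (allP l1W); rewrite WlE mem_cat zW.
have [/size0nil Wb0|Wb0] := posnP (size Wb); last first.
  apply: (@window_low m r j h' s1 Wa Wb Wr s2 q) => //.
  - move=> W' s2' a1 a2 a3 a4 a5; exact: (IH r h' s1 W' s2').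
  - by move: sh'; rewrite WE WlE -!catA.
  - by move: us; rewrite WE WlE -!catA.
  - by rewrite -WlE.
  - by move: bal1; rewrite WlE size_cat.
  - by move: bal2; rewrite WlE size_cat.
  - by move: mj; rewrite WE WlE -!catA; clear; lia.
  - by move: mB; rewrite WE WlE -!catA ?size_cat; clear; lia.
(* [Wd] reflects the points of the right half that lie below [q]. *)
have [|Wc [Wd [WrE Wcy yWd]]] := @sorted_up_split (1 - y) (rrefl Wr).
  by rewrite sorted_rrefl.
have [/size0nil Wd0|Wd0] := posnP (size Wd); last first.
  have E : rrefl s2 ++ Wc ++ Wd ++ rrefl Wl ++ rrefl s1 = rrefl (s1 ++ W ++ s2).
    by rewrite WE !rrefl_cat WrE -!catA.
  have sWrE : size Wr = (size Wc + size Wd)%N.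
    by rewrite -size_cat -WrE size_rrefl.
  rewrite -[h'](@map_reflK R); apply: forced_refl.
  apply: (@window_low m r j _ (rrefl s2) Wc Wd (rrefl Wl) (rrefl s1) (refl q)).
  - exact: in_square_refl.
  - move=> W' s2' a1 a2 a3 a4 a5; apply: (IH r _ (rrefl s2) W' s2') => //.
      exact: in_square_refl.
    exact: first_above_refl.
  - by rewrite mem_refl.
  - by rewrite E; exact: all_mem_refl.
  - by rewrite E sorted_rrefl.
  - exact: first_above_refl.
  - exact: last_under_refl.
  - rewrite -WrE -rrefl_cat; exact: right_of_refl.
  - rewrite -rrefl_cat; exact: left_of_refl.
  - rewrite all_cat; apply/andP; split; apply/allP => z zs.
      move: zs; rewrite mem_rrefl => zs2; rewrite -[z](@reflK R) up_refl.
      exact: (allP qs2).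
    rewrite /up (allP Wcy z zs) andbT.
    apply: (allP (right_of_refl r2W)).
    by rewrite WrE mem_cat zs.
  - exact: yWd.
  - by [].
  - by rewrite size_rrefl -sWrE.
  - by rewrite size_rrefl -sWrE.
  - by rewrite E size_rrefl; move: mj; clear; lia.
  - by rewrite E !size_rrefl -sWrE; move: mB; rewrite sW; clear; lia.
have yWr : all (fun p => y <= p.2) Wr.
  by apply: all_le_rrefl; rewrite WrE Wd0 cats0.
apply: (IH r.+1 h' s1 (Wl ++ q :: Wr) s2) => //.
- by rewrite !all_cat /= s1h' Wlh' qh' Wrh'.
- rewrite -catA /= catA; apply: sorted_up_insert => //.
    by move: saq; rewrite WlE Wb0 cats0.
  rewrite all_cat qs2 andbT; apply/allP => z zW.
  by rewrite /up (allP r2W z zW) (allP yWr z zW).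
- by move: mj; rewrite WE !size_cat /=; clear; lia.
- by move: mB; rewrite WE !size_cat /=; clear; lia.
Qed.

Lemma forced_bin m r : (m <= 'C(r, 3))%N -> forced m (m + r) ([::] : seq (R * R)).
Proof.
move=> mr; apply: (@window_win m r _ [::] [::] [::] [::]) => //=.
- by case.
- by rewrite subn0.
Qed.

End PlayerA.

(** * Lower bound: a strategy for player B *)

Section PlayerB.
Variable R : realType.
Implicit Types (x y : R) (p q u c d : R * R) (s h S W : seq (R * R)).
Implicit Types (m n r : nat).

(** * Sets with slack for wasted turns *)

Definition below p q := (p.1 < q.1) && (p.2 < q.2).

Lemma below_trans : transitive below.
Proof.
move=> q p d /andP[pq1 pq2] /andP[qd1 qd2].
by rewrite /below (lt_trans pq1) // (lt_trans pq2).
Qed.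

Lemma below_refl p q : below (refl p) (refl q) = below q p.
Proof. by rewrite /below /= !ltrD2l !ltrN2. Qed.

Lemma below_inverted p q : below p q -> inverted p q = false.
Proof. by move=> /andP[_ pq]; rewrite /inverted (lt_gtF pq) andbF. Qed.

Lemma below_inverted_rev p q : below p q -> inverted q p = false.
Proof. by move=> /andP[pq _]; rewrite /inverted (lt_gtF pq). Qed.

Definition down_free S := forall p q d, p \in S -> q \in S -> d \in S ->
  inverted p q -> inverted q d -> False.

Definition runs_le l S :=
  forall s, {subset s <= S} -> sorted (@up R) s -> (size s <= l)%N.

(* The points [S] lie above and to the right of a window; [r] is the number of
   turns that B still has to waste.  The slack [r] in [good_under] is what a
   further point, put under another one, may use up. *)
Record good r l S : Prop := Good {
  good_down_free : down_free S;
  good_runs : runs_le l S;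
  good_under : forall s p, {subset s <= S} -> sorted (@up R) s -> p \in s ->
    under S p -> (size s + r <= l)%N;
  good_tail : (0 < r)%N -> forall s p, p \in S -> {subset s <= S} ->
    sorted (@up R) s -> right_of p.1 s -> (size s < l)%N }.

(** Both parts are filters of [s]; points common to [S1] and [S2] count twice, hence an
    inequality. *)
Lemma run_split S1 S2 s : {subset s <= S1 ++ S2} -> sorted (@up R) s ->
  exists s1 s2, [/\ sorted (@up R) s1, sorted (@up R) s2,
    s1 =i [pred p | (p \in S1) && (p \in s)],
    s2 =i [pred p | (p \in S2) && (p \in s)] &
    (size s <= size s1 + size s2)%N].
Proof.
move=> sS us; exists (seq.filter (mem S1) s), (seq.filter (mem S2) s); split.
- exact: (sorted_filter (@up_trans R)).
- exact: (sorted_filter (@up_trans R)).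
- by move=> p; rewrite mem_filter.
- by move=> p; rewrite mem_filter.
rewrite !size_filter -count_predUI.
apply: leq_trans (leq_addr _ _); rewrite -[X in (_ <= X)%N]size_filter.
suff -> : seq.filter (predU (mem S1) (mem S2)) s = s by [].
by apply/all_filterP/allP => p /sS; rewrite mem_cat.
Qed.

Lemma runs_size s S : {subset s <= S} -> sorted (@up R) s -> (size s <= size S)%N.
Proof. by move=> sS /up_uniq us; apply: uniq_leq_size. Qed.

Lemma sorted_below_inverted W p q : sorted below W -> p \in W -> q \in W ->
  inverted p q = false.
Proof.
move=> sW; rewrite (sorted_pairwise below_trans) in sW.
elim: W sW => //= c W IH /andP[/allP cW sW]; rewrite !inE.
case/predU1P => [->|pW] /predU1P[->|qW].
- by rewrite /inverted ltxx.
- by rewrite below_inverted ?cW.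
- by rewrite below_inverted_rev ?cW.
- exact: IH.
Qed.

Lemma inverted_cat W S p q : sorted below W -> allrel below W S ->
  p \in W ++ S -> q \in W ++ S -> inverted p q -> p \in S /\ q \in S.
Proof.
move=> sW /allrelP WS; rewrite !mem_cat => /orP[pW|pS] /orP[qW|qS] //.
- by rewrite (sorted_below_inverted sW).
- by rewrite below_inverted ?WS.
- by rewrite below_inverted_rev ?WS.
Qed.

(** No point of [W] takes part in an inversion, so runs gain at most [size W] points and the slack
    is unchanged. *)
Lemma good_cat r b W S : sorted below W -> allrel below W S -> good r b S ->
  good r (size W + b) (W ++ S).
Proof.
move=> sW WS gS; split.
- move=> p q d pS qS dS pq qd.
  have [{}pS _] := inverted_cat sW WS pS qS pq.
  have [{}qS {}dS] := inverted_cat sW WS qS dS qd.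
  exact: (good_down_free gS pS qS dS).
- move=> s sS us; have [s1 [s2 [us1 us2 s1E s2E]]] := run_split sS us.
  move/leq_trans; apply; apply: leq_add.
    by apply: runs_size us1 => z; rewrite s1E => /andP[].
  by apply: (good_runs gS) us2 => z; rewrite s2E => /andP[].
- move=> s p sS us ps [u uS up].
  have [{}uS pS] := inverted_cat sW WS uS (sS p ps) up.
  have [s1 [s2 [us1 us2 s1E s2E]]] := run_split sS us.
  rewrite -(leq_add2r r) => /leq_trans; apply; rewrite -addnA; apply: leq_add.
    by apply: runs_size us1 => z; rewrite s1E => /andP[].
  apply: (@good_under _ _ _ gS s2 p) => //; first by move=> z; rewrite s2E => /andP[].
    by rewrite s2E; apply/andP.
  by exists u.
- move=> r0 s p pS sS us ps.
  have [s1 [s2 [us1 us2 s1E s2E]]] := run_split sS us.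
  have s2S : {subset s2 <= S} by move=> z; rewrite s2E => /andP[].
  have s1W : {subset s1 <= W} by move=> z; rewrite s1E => /andP[].
  have ps1 z : z \in s1 -> p.1 < z.1.
    by rewrite s1E => /andP[_] /(allP ps).
  move/leq_ltn_trans; apply; move: pS; rewrite mem_cat => /orP[pW|pS].
    rewrite -addSn; apply: leq_add; last exact: (good_runs gS).
    have : {subset p :: s1 <= W} by move=> z; rewrite inE => /predU1P[->//|/s1W].
    apply: uniq_leq_size; rewrite /= (up_uniq us1) andbT.
    by apply/negP => /ps1; rewrite ltxx.
  rewrite -addnS; apply: leq_add; first exact: runs_size.
  apply: (good_tail gS r0 pS) => //.
  by apply/allP => z; rewrite s2E => /andP[_] /(allP ps).
Qed.

(* The height [y] is the lowest one at which a point of abscissa [x] completes no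
   3-down-run: right above the points of [S] that lie to the left of [x] and under
   another one, or below all of [S] if there are none. *)
Definition cut S x y :=
  (forall d, d \in S -> d.1 < x -> under S d -> d.2 < y) /\
  (forall p, p \in S -> p.2 <= y ->
     exists2 d, d \in S & [/\ d.1 < x, under S d & p.2 <= d.2]).

(** [Lo] holds points that the answer must stay above in any case. [low] is the boolean form of the
    last clause of [cut]; [y] separates the low points from the others. *)
Lemma exists_cut Lo S x : all (@in_square R) (Lo ++ S) ->
  (forall p q, p \in Lo -> q \in S -> p.2 < q.2) ->
  exists y, [/\ 0 < y < 1, all (fun p => p.2 < y) Lo & cut S x y].
Proof.
move=> /allP sq LoS.
pose low p := has (fun d => [&& d.1 < x, has (fun u => inverted u d) S & p.2 <= d.2]) S.
have lowP p : reflect (exists2 d, d \in S & [/\ d.1 < x, under S d & p.2 <= d.2]) (low p).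
  apply: (iffP hasP) => [[d dS /and3P[dx /hasP[u uS ud] pd]]|[d dS [dx [u uS ud] pd]]].
    by exists d => //; split => //; exists u.
  by exists d => //; rewrite dx pd andbT /=; apply/hasP; exists u.
have [| | |y [y01 lo hi]] := @exists_between R
    (map snd (Lo ++ seq.filter low S)) (map snd (seq.filter (predC low) S)).
- move=> _ _ /mapP[p + ->] /mapP[q + ->].
  rewrite mem_cat !mem_filter => /orP[pLo /andP[_ qS]|]; first exact: LoS.
  case/andP => /lowP[d dS [dx ud pd]] pS /andP[nq qS].
  apply: le_lt_trans pd _; rewrite ltNge; apply: contra nq => qd.
  by apply/lowP; exists d.
- rewrite all_map; apply/allP => p; rewrite mem_cat mem_filter => pS.
  have /sq/andP[_ /andP[]//] : p \in Lo ++ S.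
  by rewrite mem_cat; case/orP: pS => [->//|/andP[_ ->]]; rewrite orbT.
- rewrite all_map; apply/allP => p; rewrite mem_filter => /andP[_ pS].
  have /sq/andP[_ /andP[]//] : p \in Lo ++ S by rewrite mem_cat pS orbT.
exists y; move: lo hi; rewrite !all_map all_cat => /andP[loLo /allP lo] /allP hi.
split => //; split => [d dS dx ud|p pS py].
  by apply: lo; rewrite mem_filter dS andbT; apply/lowP; exists d.
apply/lowP; apply: contraLR py => np; rewrite -ltNge.
by apply: hi; rewrite mem_filter /= np.
Qed.

(** * Effect of the lowest answer without a 3-down-run *)

Section Cut.
Variables (S : seq (R * R)) (x y : R).
Hypotheses (S_down_free : down_free S) (cutS : cut S x y).
Hypotheses (S_inj1 : {in S &, injective fst}) (S_inj2 : {in S &, injective snd}).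
Hypothesis xS : forall p, p \in S -> p.1 != x.
Let q := (x, y).

Lemma cut_neq p : p \in S -> p.2 != y.
Proof.
move=> pS; apply/negP => /eqP py; have [cut1 cut2] := cutS.
have [|d dS [dx ud pd]] := cut2 p pS; first by rewrite py.
by have := cut1 d dS dx ud; rewrite ltNge -py pd.
Qed.

(** Otherwise [p] is below some [d] left of [x] that is itself under a third point. *)
Lemma cut_right p : p \in S -> x < p.1 -> y < p.2.
Proof.
move=> pS xp; rewrite ltNge; apply/negP => py.
have [d dS [dx [u uS ud] pd]] := cutS.2 p pS py.
have dp : d.1 < p.1 by exact: lt_trans xp.
apply: (S_down_free uS dS pS ud); rewrite /inverted dp lt_neqAle pd andbT.
by apply/negP => /eqP/(S_inj2 pS dS) pdE; rewrite pdE ltxx in dp.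
Qed.

(** By [cut_right] the new point could only end a 3-down-run, but it is above every point to its
    left that lies under another one. *)
Lemma cut_down_free : down_free (q :: S).
Proof.
have nq p : p \in q :: S -> inverted q p = false.
  rewrite inE => /predU1P[->|pS]; first by rewrite /inverted ltxx.
  apply/negP => /andP[/= xp]; apply/negP; rewrite -leNgt ltW //.
  exact: cut_right.
move=> p1 p2 p3 + + + i12 i23.
rewrite inE => /predU1P[p1E p2S _|p1S]; first by rewrite p1E nq in i12.
rewrite inE => /predU1P[p2E p3S|p2S]; first by rewrite p2E nq in i23.
rewrite inE => /predU1P[p3E|p3S]; last exact: (S_down_free p1S p2S p3S).
move: i23; rewrite p3E => /andP[/= p2x]; apply/negP; rewrite -leNgt ltW //.
by apply: cutS.1 => //; exists p1.
Qed.

(* If the new point is not the first of the run [s], then its predecessor can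
   be followed, or replaced, by a point of [S] that lies under another one. *)
Lemma cut_run s : {subset s <= q :: S} -> sorted (@up R) s -> q \in s ->
  (exists s' d, [/\ {subset s' <= S}, sorted (@up R) s', d \in s', under S d &
     (size s <= (size s').+1)%N]) \/
  (exists s', [/\ {subset s' <= S}, sorted (@up R) s', right_of x s' &
     size s = (size s').+1]).
Proof.
move=> sS us qs; move: us sS; case/splitPr: qs => s1 s2.
rewrite sorted_up_cat sorted_up_cons => /and3P[us1 /andP[qs2 us2] /allrelP s12] sS.
have s1q p : p \in s1 -> up p q by move=> ps; apply: s12; rewrite ?mem_head.
have s1S : {subset s1 <= S}.
  move=> p ps; have := sS p; rewrite mem_cat ps inE => /(_ isT) /predU1P[pq|//].
  by have := s1q p ps; rewrite pq up_irr.
have s2S : {subset s2 <= S}.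
  move=> p ps; have := sS p; rewrite mem_cat !inE ps !orbT => /(_ isT).
  by case/predU1P => [pq|//]; have := allP qs2 p ps; rewrite pq up_irr.
case/lastP: s1 => [|s1 p] in us1 s12 sS s1q s1S *.
  right; exists s2; split => //; apply/allP => p /(allP qs2) /andP[]//.
left; have /andP[px py] : up p q by apply: s1q; rewrite mem_rcons mem_head.
have pS : p \in S by apply: s1S; rewrite mem_rcons mem_head.
have [d dS [dx ud pd]] := cutS.2 p pS py.
have [dp|pdn] := eqVneq d p.
  exists (rcons s1 p ++ s2), d; split => //.
  - by move=> z; rewrite mem_cat => /orP[/s1S|/s2S].
  - rewrite sorted_up_cat us1 us2; apply/allrelP => a b a1 b2.
    by apply: s12; rewrite // inE b2 orbT.
  - by rewrite dp mem_cat mem_rcons mem_head.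
  - by rewrite !size_cat /= addnS.
have pd2 : p.2 < d.2.
  rewrite lt_neqAle pd andbT; apply: contra pdn => /eqP/(S_inj2 pS dS)->.
  exact: eqxx.
have pd1 : p.1 < d.1.
  rewrite ltNge le_eqVlt; apply/negP => /predU1P[/(S_inj1 dS pS) dp|dp].
    by rewrite dp eqxx in pdn.
  have [u uS iud] := ud.
  by apply: (S_down_free uS dS pS iud); rewrite /inverted dp.
have d2 : all (up d) s2.
  apply/allP => z zs; have /andP[/= xz _] := allP qs2 z zs.
  rewrite /up (lt_trans dx xz) /= ltW // (lt_trans (cutS.1 d dS dx ud)) //.
  exact: cut_right (s2S z zs) xz.
exists (rcons (rcons s1 p) d ++ s2), d; split => //.
- move=> z; rewrite mem_cat mem_rcons inE => /orP[/predU1P[->//|/s1S//]|/s2S//].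
- rewrite cat_rcons; apply: sorted_up_insert => //.
    rewrite sorted_up_cat us1 us2; apply/allrelP => a b a1 b2.
    by apply: s12; rewrite // inE b2 orbT.
  apply/allP => z; rewrite mem_rcons inE => /predU1P[->|zs].
    by rewrite /up pd1 ltW.
  apply: (@up_trans _ p); last by rewrite /up pd1 ltW.
  move: us1; rewrite -cats1 sorted_up_cat => /and3P[_ _ /allrelP]; apply => //.
  exact: mem_head.
- by rewrite mem_cat mem_rcons mem_head.
- by rewrite !size_cat !size_rcons /=; clear; lia.
Qed.

End Cut.

(** A run through the new point may come from a run with a point under another one; one unit of the
    slack [r.+1] then pays for the new point. Or it starts at the new point; then it misses the [r]
    points of [W] and, right of [p0], has fewer than [b] further points. *)
Lemma good_play r b S W x y p0 : sorted below W -> allrel below W S ->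
  size W = r -> good r.+1 b S -> p0 \in S -> p0.1 < x -> cut (W ++ S) x y ->
  {in W ++ S &, injective fst} -> {in W ++ S &, injective snd} ->
  (forall p, p \in W ++ S -> p.1 != x) ->
  good r (r + b) ((x, y) :: W ++ S).
Proof.
move=> sW WS Wr gS p0S p0x cu i1 i2 xS.
have gT := good_cat sW WS gS; rewrite Wr in gT.
have df := good_down_free gT.
have tail s : {subset s <= W ++ S} -> sorted (@up R) s -> right_of x s ->
    (size s < b)%N.
  move=> sS us sx; have sp0 : right_of p0.1 s.
    by apply/allP => z /(allP sx) /=; exact: lt_trans.
  apply: (good_tail gS _ p0S) => // z zs.
  have := sS z zs; rewrite mem_cat => /orP[zW|//].
  have /andP[zp0 _] := allrelP WS z p0 zW p0S.
  by have := lt_trans zp0 (allP sp0 z zs); rewrite ltxx.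
have qS s : {subset s <= (x, y) :: W ++ S} -> (x, y) \notin s ->
    {subset s <= W ++ S}.
  move=> sS qs z zs; have := sS z zs; rewrite inE => /predU1P[zq|//].
  by rewrite -zq zs in qs.
have run s : {subset s <= (x, y) :: W ++ S} -> sorted (@up R) s ->
    (x, y) \in s -> (size s + r <= r + b)%N.
  move=> sS us qs.
  have [[s' [d [s'S us' ds' ud ss']]]|[s' [s'S us' s'x ->]]] :=
    cut_run df cu i1 i2 sS us qs.
    by have := good_under gT s'S us' ds' ud; move: ss'; clear; lia.
  by have := tail s' s'S us' s'x; clear; lia.
split.
- exact: cut_down_free.
- move=> s sS us; have [qs|qs] := boolP ((x, y) \in s).
    by have := run s sS us qs; clear; lia.
  exact: (good_runs gT (qS s sS qs)).
- move=> s p sS us ps up; have [qs|qs] := boolP ((x, y) \in s).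
    exact: run.
  have pS := qS s sS qs p ps.
  have : (size s + r.+1 <= r + b)%N.
    apply: (good_under gT (qS s sS qs) us ps); have [u + iu] := up.
    rewrite inE => /predU1P[uq|uS]; last by exists u.
    move: iu; rewrite uq => /andP[/= xp py].
    by have := cut_right df cu i2 pS xp; rewrite ltNge ltW.
  by clear; lia.
- move=> r0 s p pS sS us sp; have [qs|qs] := boolP ((x, y) \in s).
    by have := run s sS us qs; move: r0; clear; lia.
  have {}sS := qS s sS qs.
  move: pS; rewrite inE => /predU1P[pq|pS].
    have := tail s sS us; rewrite pq in sp => /(_ sp) /leq_trans; apply.
    exact: leq_addl.
  exact: (good_tail gT (ltn0Sn r) pS sS us sp).
Qed.

(** * The window between its two sides *)

Lemma allrel_below_refl s1 s2 : allrel below s1 s2 ->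
  allrel below (map (@refl R) s2) (map (@refl R) s1).
Proof.
move=> /allrelP H; apply/allrelP => p q; rewrite !mem_refl2 => ps qs.
by rewrite -[p](@reflK R) -[q](@reflK R) below_refl; apply: H.
Qed.

Lemma down_free_refl S : down_free (map (@refl R) S) -> down_free S.
Proof.
move=> H p q d pS qS dS pq qd.
by apply: (H (refl d) (refl q) (refl p)); rewrite ?mem_refl ?inverted_refl.
Qed.

Lemma down_free_cat S1 S2 : allrel below S1 S2 -> down_free S1 ->
  down_free S2 -> down_free (S1 ++ S2).
Proof.
move=> /allrelP S12 H1 H2 p q d; rewrite !mem_cat.
case/orP=> pS; case/orP=> qS; case/orP=> dS pq qd.
- exact: (H1 _ _ _ pS qS dS).
- by rewrite below_inverted ?S12 in qd.
- by rewrite below_inverted ?S12 in pq.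
- by rewrite below_inverted ?S12 in pq.
- by rewrite below_inverted_rev ?S12 in pq.
- by rewrite below_inverted_rev ?S12 in pq.
- by rewrite below_inverted_rev ?S12 in qd.
- exact: (H2 _ _ _ pS qS dS).
Qed.

Lemma good_leS r l S : good r.+1 l S -> good r l S.
Proof.
move=> [df ru un ta]; split => // [s p sS us ps up|_].
  by apply: leq_trans (un s p sS us ps up); rewrite leq_add2l.
exact: ta.
Qed.

(* The set [h] is the window [W] between the points [s1], below it, and the points
   [s2], above it.  The size of the window matters only once the corresponding
   side is occupied. *)
Record splits r L h s1 W s2 a b : Prop := Splits {
  splits_mem : h =i s1 ++ W ++ s2;
  splits_sorted : sorted below W;
  splits_1W : allrel below s1 W;
  splits_12 : allrel below s1 s2;
  splits_W2 : allrel below W s2;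
  splits_good1 : good r a (map (@refl R) s1);
  splits_good2 : good r b s2;
  splits_size1 : s1 = [::] \/ ('C(r, 2) <= size W)%N;
  splits_size2 : s2 = [::] \/ ('C(r, 2) <= size W)%N;
  splits_L : L = (a + size W + b)%N }.

Definition state r M L h :=
  exists s1 W s2 a b, splits r L h s1 W s2 a b /\ size W = M.

Lemma eq_mem_state r M L h h' : h =i h' -> state r M L h -> state r M L h'.
Proof.
move=> hh [s1 [W [s2 [a [b [[? ? ? ? ? ? ? ? ? ?] ?]]]]]].
by exists s1, W, s2, a, b; split => //; split => // p; rewrite -hh.
Qed.

Lemma splits_refl r L h s1 W s2 a b : splits r L h s1 W s2 a b ->
  splits r L (map (@refl R) h) (map (@refl R) s2) (rrefl W) (map (@refl R) s1) b a.
Proof.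
move=> [hE sW s1W s12 Ws2 g1 g2 z1 z2 LE]; split.
- move=> p; rewrite mem_refl2 hE !mem_cat !mem_refl2 mem_rrefl.
  by case: (refl p \in s1); case: (refl p \in W); case: (refl p \in s2).
- rewrite /rrefl rev_sorted sorted_map; move: sW; congr (is_true _).
  by apply: eq_sorted => p q; rewrite /relpre /= below_refl.
- have /allrelP H := allrel_below_refl Ws2; apply/allrelP => p q ps.
  by rewrite mem_rev => qs; exact: H.
- exact: allrel_below_refl.
- have /allrelP H := allrel_below_refl s1W; apply/allrelP => p q.
  by rewrite mem_rev => qs; exact: H.
- by rewrite map_reflK.
- by [].
- by rewrite size_rrefl; case: z2 => [->|]; [left|right].
- by rewrite size_rrefl; case: z1 => [->|]; [left|right].
- by rewrite size_rrefl LE; clear; lia.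
Qed.

Lemma state_refl r M L h : state r M L h -> state r M L (map (@refl R) h).
Proof.
move=> [s1 [W [s2 [a [b [sp WM]]]]]].
exists (map (@refl R) s2), (rrefl W), (map (@refl R) s1), b, a.
by rewrite size_rrefl; split => //; exact: splits_refl.
Qed.

Lemma state_down_free r M L h : state r M L h -> down_free h.
Proof.
move=> [s1 [W [s2 [a [b [[hE sW s1W s12 Ws2 g1 g2 z1 z2 LE] WM]]]]]].
move=> p q d; rewrite !hE; apply: down_free_cat.
- by rewrite allrel_catr s1W s12.
- exact: (down_free_refl (good_down_free g1)).
- exact: (good_down_free (good_cat sW Ws2 g2)).
Qed.

Lemma state_runs r M L h : state r M L h -> runs_le L h.
Proof.
move=> [s1 [W [s2 [a [b [[hE sW s1W s12 Ws2 g1 g2 z1 z2 ->] WM]]]]]].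
move=> s sh us; have sS : {subset s <= s1 ++ W ++ s2}.
  by move=> p /sh; rewrite hE.
have [t1 [t2 [u1 u2 t1E t2E]]] := run_split sS us.
move/leq_trans; apply; rewrite -addnA; apply: leq_add.
  rewrite -size_rrefl; apply: (good_runs g1); last by rewrite sorted_rrefl.
  by move=> p; rewrite mem_rrefl t1E mem_refl2 => /andP[].
by apply: (good_runs (good_cat sW Ws2 g2)) u2 => p; rewrite t2E => /andP[].
Qed.

Definition square_inj h :=
  [/\ all (@in_square R) h, {in h &, injective fst} & {in h &, injective snd}].

Lemma square_inj_refl h : square_inj h -> square_inj (map (@refl R) h).
Proof.
move=> [sq i1 i2]; split; first exact: in_square_refl.
- move=> p q; rewrite !mem_refl2 => ph qh pq; apply: (@refl_inj R).
  by apply: i1 => //=; rewrite pq.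
- move=> p q; rewrite !mem_refl2 => ph qh pq; apply: (@refl_inj R).
  by apply: i2 => //=; rewrite pq.
Qed.

Lemma square_inj_rcons h x y : square_inj h -> 0 < x < 1 -> 0 < y < 1 ->
  (forall p, p \in h -> p.1 != x) -> (forall p, p \in h -> p.2 != y) ->
  square_inj (rcons h (x, y)).
Proof.
move=> [sq i1 i2] x01 y01 hx hy; split; first exact: in_square_rcons.
- move=> p q; rewrite !mem_rcons !inE.
  case/predU1P=> [->|ph]; case/predU1P=> [->|qh] //=.
  + by move=> E; have := hx _ qh; rewrite -E eqxx.
  + by move=> E; have := hx _ ph; rewrite E eqxx.
  + exact: i1.
- move=> p q; rewrite !mem_rcons !inE.
  case/predU1P=> [->|ph]; case/predU1P=> [->|qh] //=.
  + by move=> E; have := hy _ qh; rewrite -E eqxx.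
  + by move=> E; have := hy _ ph; rewrite E eqxx.
  + exact: i2.
Qed.

(** Used in states with [r.+1]: the answer wastes the turn, since the bound [L] on the runs is kept
    while only [r] wasted turns remain due. *)
Definition can_play r L h x := exists y, [/\ 0 < y < 1,
  (forall p, p \in h -> p.2 != y) &
  exists2 M, ('C(r, 2) <= M)%N & state r M L (rcons h (x, y))].

Lemma can_play_refl r L h x :
  can_play r L (map (@refl R) h) (1 - x) -> can_play r L h x.
Proof.
move=> [y [y01 hy [M rM st]]]; exists (1 - y); split.
- exact: refl01.
- move=> p ph; have := hy (refl p); rewrite mem_refl => /(_ ph).
  by apply: contra => /eqP /= ->; rewrite subKr.
- exists M => //; have := state_refl st.
  by rewrite map_rcons map_reflK /refl /= subKr.
Qed.

(** The last [r] points of the window pass, with the new point, to the upper side. Its bound grows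
    by [r], so [L] is unchanged, and at least ['C(r.+1, 2) - r = 'C(r, 2)] points stay in the
    window. *)
Lemma play_right r L h s1 W s2 a b x p0 : splits r.+1 L h s1 W s2 a b ->
  square_inj h -> (forall p, p \in h -> p.1 != x) ->
  ('C(r.+1, 2) <= size W)%N -> p0 \in s2 -> p0.1 < x -> can_play r L h x.
Proof.
move=> [hE sW s1W s12 Ws2 g1 g2 z1 z2 LE] [sq i1 i2] hx rW p0s2 p0x.
rewrite binS bin1 in rW.
pose W1 := take (size W - r) W; pose W2 := drop (size W - r) W.
have WE : W = W1 ++ W2 by rewrite cat_take_drop.
have sW2 : size W2 = r by rewrite size_drop; move: rW; clear; lia.
have sW1 : size W1 = (size W - r)%N by rewrite size_takel //; clear; lia.
have sub p : p \in W2 ++ s2 -> p \in h.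
  by rewrite hE WE !mem_cat => /orP[->|->]; rewrite ?orbT.
have subLo p : p \in s1 ++ W1 -> p \in h.
  by rewrite hE WE !mem_cat => /orP[->|->]; rewrite ?orbT.
have := sW; rewrite (sorted_pairwise below_trans) WE pairwise_cat.
rewrite -!(sorted_pairwise below_trans) => /and3P[W12 uW1 uW2].
move: s1W Ws2; rewrite WE allrel_catr allrel_catl => /andP[s1W1 s1W2] /andP[W1s2 W2s2].
have LoS : allrel below (s1 ++ W1) (W2 ++ s2).
  by rewrite allrel_catl !allrel_catr s1W2 s12 W12 W1s2.
have [||y [y01 Loy cu]] := @exists_cut (s1 ++ W1) (W2 ++ s2) x.
- apply/allP => p; rewrite mem_cat => /orP[/subLo|/sub]; exact: (allP sq).
- by move=> p q ps qs; have /andP[] := allrelP LoS p q ps qs.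
have Lox : all (fun p => p.1 < x) (s1 ++ W1).
  apply/allP => p ps; apply: lt_trans p0x.
  have p0S : p0 \in W2 ++ s2 by rewrite mem_cat p0s2 orbT.
  by have /andP[] := allrelP LoS p p0 ps p0S.
have Loq : allrel below (s1 ++ W1) [:: (x, y)].
  apply/allrelP => p q ps; rewrite inE => /eqP->.
  by rewrite /below (allP Lox p ps) (allP Loy p ps).
have gq : good r (r + b) ((x, y) :: W2 ++ s2).
  apply: (@good_play _ _ _ _ _ _ p0) => //.
  - by move=> p q ps qs; apply: i1; exact: sub.
  - by move=> p q ps qs; apply: i2; exact: sub.
  - by move=> p ps; apply: hx; exact: sub.
exists y; split => //.
  move=> p; rewrite hE WE -catA catA mem_cat => /orP[ps|].
    by rewrite lt_eqF ?(allP Loy).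
  exact: cut_neq cu _.
exists (size W1); first by rewrite sW1; move: rW; clear; lia.
exists s1, W1, ((x, y) :: W2 ++ s2), a, (r + b)%N; split => //.
move: Loq LoS; rewrite !allrel_catl => /andP[s1q W1q] /andP[s1S W1S].
split => //.
- move=> p; rewrite mem_rcons inE hE WE !mem_cat inE !mem_cat.
  by case: (p == _); case: (p \in s1); case: (p \in W1); rewrite ?orbT.
- by rewrite -cat1s allrel_catr s1q.
- by rewrite -cat1s allrel_catr W1q.
- exact: good_leS.
- by right; rewrite sW1; move: rW; clear; lia.
- by right; rewrite sW1; move: rW; clear; lia.
- by rewrite LE sW1; move: rW; clear; lia.
Qed.

(** By [good_cat] the points from [c] on can be counted to the upper side; [c] then serves as [p0]
    in [play_right]. *)
Lemma window_right r L h s1 W1 c W2 s2 a b x :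
  splits r.+1 L h s1 (W1 ++ c :: W2) s2 a b ->
  square_inj h -> (forall p, p \in h -> p.1 != x) ->
  ('C(r.+1, 2) <= size W1)%N -> c.1 < x -> can_play r L h x.
Proof.
move=> [hE sW s1W s12 Ws2 g1 g2 z1 z2 LE] sq hx rW cx.
have := sW; rewrite (sorted_pairwise below_trans) pairwise_cat.
rewrite -!(sorted_pairwise below_trans) => /and3P[W12 uW1 uW2].
move: s1W Ws2; rewrite allrel_catr allrel_catl => /andP[s1W1 s1W2] /andP[W1s2 W2s2].
apply: (@play_right r L h s1 W1 ((c :: W2) ++ s2) a (size (c :: W2) + b) x c) => //.
- split => //.
  + by move=> p; rewrite hE -catA.
  + by rewrite allrel_catr s1W2.
  + by rewrite allrel_catr W12.
  + exact: good_cat.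
  + by right.
  + by right.
  + by rewrite LE size_cat; clear; lia.
- exact: mem_head.
Qed.

Lemma sorted_below_split W x : sorted below W -> (forall p, p \in W -> p.1 != x) ->
  exists W1 W2, [/\ W = W1 ++ W2, left_of x W1 & right_of x W2].
Proof.
elim: W => [|p W IH] sW Wx; first by exists [::], [::].
have := sW; rewrite /= (path_sortedE below_trans) => /andP[/allP pW /IH].
case=> [q qW|W1 [W2 [WE W1x xW2]]]; first by apply: Wx; rewrite inE qW orbT.
have [xp|px|E] := ltgtP x p.1.
- exists [::], (p :: W); split => //; rewrite /right_of /= xp.
  by apply/allP => z /pW /andP[+ _]; exact: lt_trans.
- by exists (p :: W1), W2; rewrite WE /left_of /= px.
- by have := Wx p (mem_head _ _); rewrite E eqxx.
Qed.

(** B prolongs the window only if at most ['C(r.+1, 2)] of its points lie on each side of [x],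
    whence the bound on [M]. *)
Lemma play_state r M L h x : state r.+1 M L h -> square_inj h -> 0 < x < 1 ->
  (forall p, p \in h -> p.1 != x) -> can_play r L h x \/
  ((M <= 2 * 'C(r.+1, 2))%N /\
   exists y, [/\ 0 < y < 1, (forall p, p \in h -> p.2 != y) &
     state r.+1 M.+1 L.+1 (rcons h (x, y))]).
Proof.
move=> [s1 [W [s2 [a [b [sp <-]]]]]] sq x01 hx.
have hx' p : p \in map (@refl R) h -> p.1 != 1 - x.
  rewrite mem_refl2 => /hx; apply: contra => /eqP /= ->.
  by rewrite subKr.
have hE := splits_mem sp.
have hx1 p : p \in s1 -> p.1 != x by move=> ps; apply: hx; rewrite hE mem_cat ps.
have hx2 p : p \in s2 -> p.1 != x.
  by move=> ps; apply: hx; rewrite hE !mem_cat ps !orbT.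
have hxW p : p \in W -> p.1 != x.
  by move=> ps; apply: hx; rewrite hE !mem_cat ps !orbT.
have [/hasP[p0 p0s p0x]|/hasPn s2x] := boolP (has (fun p => p.1 < x) s2).
  left; apply: (play_right sp sq hx _ p0s p0x).
  by case: (splits_size2 sp) p0s => [->|//].
have [/hasP[p0 p0s p0x]|/hasPn s1x] := boolP (has (fun p => x < p.1) s1).
  left; apply: can_play_refl.
  apply: (play_right (p0 := refl p0) (splits_refl sp)) => //.
  - exact: square_inj_refl.
  - rewrite size_rrefl; by case: (splits_size1 sp) p0s => [->|//].
  - by rewrite mem_refl.
  - by rewrite /= ltrD2l ltrN2.
have [sW s1W s12 Ws2] :=
  And4 (splits_sorted sp) (splits_1W sp) (splits_12 sp) (splits_W2 sp).
have {s1x}l1 : left_of x s1.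
  by apply/allP => p ps; rewrite lt_neqAle hx1 //= leNgt s1x.
have {s2x}r2 : right_of x s2.
  by apply/allP => p ps; rewrite lt_neqAle eq_sym hx2 //= leNgt s2x.
have [W1 [W2 [WE lW1 rW2]]] := sorted_below_split sW hxW.
have [W1b|W1s] := ltnP 'C(r.+1, 2) (size W1).
  left; case/lastP: W1 => [//|W1 c] in WE lW1 W1b *.
  rewrite size_rcons ltnS in W1b.
  have cx : c.1 < x by apply: (allP lW1); rewrite mem_rcons mem_head.
  by rewrite WE cat_rcons in sp; exact: (window_right sp).
have [W2b|W2s] := ltnP 'C(r.+1, 2) (size W2).
  left; case: W2 => [//|c W2] in WE rW2 W2b *.
  apply: can_play_refl; move: (splits_refl sp).
  rewrite WE rrefl_cat rrefl_cons cat_rcons => /window_right; apply => //.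
  - exact: square_inj_refl.
  - by rewrite size_rrefl.
  - by rewrite /= ltrD2l ltrN2; case/andP: rW2.
right; split; first by rewrite WE size_cat; move: W1s W2s; clear; lia.
move: s1W Ws2; rewrite WE allrel_catr allrel_catl => /andP[s1W1 s1W2] /andP[W1s2 W2s2].
have := sW; rewrite (sorted_pairwise below_trans) WE pairwise_cat.
move=> /and3P[W12 uW1 uW2].
have LoS : allrel below (s1 ++ W1) (W2 ++ s2).
  by rewrite allrel_catl !allrel_catr s1W2 s12 W12 W1s2.
have hLo p : p \in s1 ++ W1 -> p \in h.
  by rewrite hE WE !mem_cat => /orP[->|->]; rewrite ?orbT.
have hHi p : p \in W2 ++ s2 -> p \in h.
  by rewrite hE WE !mem_cat => /orP[->|->]; rewrite ?orbT.
have [sqh _ _] := sq.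
have [| | |y [y01 lo hi]] :=
    @exists_between R (map snd (s1 ++ W1)) (map snd (W2 ++ s2)).
- move=> _ _ /mapP[p ps ->] /mapP[q qs ->].
  by have /andP[] := allrelP LoS p q ps qs.
- by rewrite all_map; apply/allP => p /hLo /(allP sqh) /andP[_ /andP[]].
- by rewrite all_map; apply/allP => p /hHi /(allP sqh) /andP[_ /andP[]].
rewrite !all_map in lo hi.
have Lox : all (fun p => p.1 < x) (s1 ++ W1) by rewrite all_cat; apply/andP.
have Hix : all (fun p => x < p.1) (W2 ++ s2) by rewrite all_cat; apply/andP.
have Loq : allrel below (s1 ++ W1) [:: (x, y)].
  apply/allrelP => p q ps; rewrite inE => /eqP->.
  by rewrite /below (allP Lox p ps); have /= -> := allP lo p ps.
have qHi : allrel below [:: (x, y)] (W2 ++ s2).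
  apply/allrelP => p q; rewrite inE => /eqP-> qs.
  by rewrite /below (allP Hix q qs); have /= -> := allP hi q qs.
exists y; split => //.
  move=> p; rewrite hE WE -catA catA mem_cat => /orP[ps|ps].
    by rewrite lt_eqF //; exact: (allP lo).
  by rewrite gt_eqF //; exact: (allP hi).
exists s1, (W1 ++ [:: (x, y)] ++ W2), s2, a, b; split; last first.
  by rewrite !size_cat /=; clear; lia.
move: Loq qHi; rewrite allrel_catl allrel_catr => /andP[s1q W1q] /andP[qW2 qs2].
split => //.
- move=> p; rewrite mem_rcons inE hE WE !mem_cat inE.
  by case: (p == _); case: (p \in s1); case: (p \in W1); rewrite ?orbT.
- rewrite (sorted_pairwise below_trans) !pairwise_cat allrel_catr W1q W12 uW1.
  by rewrite qW2 uW2.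
- by rewrite !allrel_catr s1W1 s1q.
- by rewrite !allrel_catl W1s2 qs2.
- exact: (splits_good1 sp).
- exact: (splits_good2 sp).
- case: (splits_size1 sp) => [->|H]; [by left|right].
  by move: H; rewrite WE !size_cat /=; clear; lia.
- case: (splits_size2 sp) => [->|H]; [by left|right].
  by move: H; rewrite WE !size_cat /=; clear; lia.
- by rewrite (splits_L sp) WE !size_cat /=; clear; lia.
Qed.

(** * Counting the turns that B survives *)

Lemma not_over m L h : down_free h -> runs_le L h -> (L < m)%N ->
  ~ game_over m 3 h.
Proof.
move=> df ru Lm /game_overP[[s sh [us sm]]|[p [q [d [ph qh dh pq qd]]]]].
  by have := ru s sh us; rewrite sm leqNgt Lm.
exact: (df p q d).
Qed.

Lemma rcons_dup h p : p \in h -> h =i rcons h p.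
Proof. by move=> ph q; rewrite mem_rcons inE; case: eqP => [->|]. Qed.

Lemma not_forced_rcons m n h x y :
  0 < y < 1 -> ~ forced m n (rcons h (x, y)) ->
  ~ (forall y, 0 < y < 1 -> forced m n (rcons h (x, y))).
Proof. by move=> y01 nf /(_ y y01). Qed.

(** With no wasted turn due, B plays the cut of the whole position, and a turn adds at most one
    point to the longest run. *)
Lemma not_forced_down_free m n L h : down_free h -> runs_le L h ->
  square_inj h -> (L + n < m)%N -> ~ forced m n h.
Proof.
elim: n L h => [|n IH] L h df ru sq Lm.
  by case=> //; apply: (not_over df ru); move: Lm; rewrite addn0.
have [sqh i1 i2] := sq.
case=> [|[x x01]]; first by apply: (not_over df ru); move: Lm; clear; lia.
(* To a repeated abscissa B answers with the old point, so the set of points stays the same. *)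
have [/hasP[[x' y] ph /= /eqP E]|/hasPn hx] := boolP (has (fun p => p.1 == x) h).
  have hh := rcons_dup ph; rewrite {}E in ph hh.
  have /(allP sqh)/andP[_ y01] := ph.
  apply: (not_forced_rcons y01); apply: (IH L).
  - by move=> p q d; rewrite -!hh; exact: df.
  - by move=> s sh; apply: ru => p /sh; rewrite -hh.
  - split; first exact: in_square_rcons.
    + by move=> p q; rewrite -!hh; exact: i1.
    + by move=> p q; rewrite -!hh; exact: i2.
  - by move: Lm; clear; lia.
have [//|//|y [y01 _ cu]] := @exists_cut [::] h x.
apply: (not_forced_rcons y01); apply: (IH L.+1).
- have df' := cut_down_free df cu i2.
  by move=> p q d; rewrite !mem_rcons; exact: df'.
- move=> s sh us; have [qs|qs] := boolP ((x, y) \in s).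
    have -> : size s = (size (rem (x, y) s)).+1.
      by rewrite size_rem // prednK //; case: (s) qs.
    apply: ru; last exact: (subseq_sorted (@up_trans R) (rem_subseq _ _)).
    move=> p; rewrite (rem_filter _ (up_uniq us)) mem_filter => /andP[/= pq /sh].
    by rewrite mem_rcons inE (negPf pq).
  apply: leqW; apply: ru us => p ps; have := sh p ps.
  rewrite mem_rcons inE => /predU1P[pq|//].
  by rewrite -pq ps in qs.
- by apply: square_inj_rcons => // p ph; exact: cut_neq cu _ ph.
- by move: Lm; clear; lia.
Qed.

(* The number of further points that the longest run may have to gain before B
   has wasted [r] more turns, when the window consists of [M] points. *)
Definition cost r M :=
  if r is r'.+1 then (2 * 'C(r, 2) + 1 - M + ('C(r, 3) + r'))%N else 0%N.

(** The first bound lets B waste [r] turns before a run has [m] points; by the second, [n] turns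
    with [r] of them wasted cannot lead from [L] to [m]. *)
Lemma not_forced_state m n r M L h : state r M L h -> square_inj h ->
  (L + cost r M < m)%N -> (L + n < m + r)%N -> ~ forced m n h.
Proof.
elim: n r M L h => [|n IH] r M L h st sq Lm nm.
  case=> //; apply: (not_over (state_down_free st) (state_runs st)).
  by move: Lm; clear; lia.
case: r => [|r] in st Lm nm *.
  apply: (not_forced_down_free (state_down_free st) (state_runs st) sq).
  by move: nm; rewrite addn0.
have [sqh i1 i2] := sq.
case=> [|[x x01]].
  by apply: (not_over (state_down_free st) (state_runs st)); move: Lm; clear; lia.
have [/hasP[[x' y] ph /= /eqP E]|/hasPn hx] := boolP (has (fun p => p.1 == x) h).
  have hh := rcons_dup ph; rewrite {}E in ph hh.
  have /(allP sqh)/andP[_ y01] := ph.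
  apply: (not_forced_rcons y01); apply: (IH r.+1 M L) => //.
  - exact: eq_mem_state st.
  - split; first exact: in_square_rcons.
    + by move=> p q; rewrite -!hh; exact: i1.
    + by move=> p q; rewrite -!hh; exact: i2.
  - by move: nm; clear; lia.
have [[y [y01 hy [M' rM' st']]]|[MC [y [y01 hy st']]]] := play_state st sq x01 hx.
  apply: (not_forced_rcons y01); apply: (IH r M' L) => //.
  - exact: square_inj_rcons.
  (* By Pascal's rule, [cost k] of a window with at least ['C(k, 2)] points is at most
     ['C(k.+1, 3) + k], the last summand of [cost k.+1]. *)
  - apply: leq_ltn_trans Lm; rewrite leq_add2l.
    case: r rM' {st' st nm} => [//|r] rM'.
    by rewrite /cost !binS ?bin1 ?bin0; rewrite !binS ?bin1 in rM'; move: rM'; clear; lia.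
  - by move: nm; clear; lia.
apply: (not_forced_rcons y01); apply: (IH r.+1 M.+1 L.+1) => //.
- exact: square_inj_rcons.
- by move: Lm MC; rewrite /cost; clear; lia.
- by move: nm; clear; lia.
Qed.

(** For the empty window, [cost t 0] is ['C(t, 3) + 2 'C(t, 2) + t], which is ['C(t.+2, 3)]. *)
Lemma not_forced_bin m t : ('C(t.+2, 3) < m)%N ->
  ~ forced m (m + t).-1 ([::] : seq (R * R)).
Proof.
move=> tm; apply: (@not_forced_state m _ t 0 0).
- exists [::], [::], [::], 0%N, 0%N; split => //.
  have g0 : good t 0 ([::] : seq (R * R)).
    have nil s : {subset s <= ([::] : seq (R * R))} -> size s = 0%N.
      by case: s => // p s /(_ p (mem_head _ _)).
    split => //.
    - by move=> s /nil->.
    - by move=> s p /nil/size0nil ->.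
  by split => //; left.
- by split.
- apply: leq_ltn_trans tm; rewrite add0n; case: t => [//|t].
  by rewrite /cost !binS ?bin1 ?bin0; clear; lia.
- by move: tm; clear; lia.
Qed.

End PlayerB.

(** * From binomial coefficients to the cube root *)

Lemma bin3E t : (6 * 'C(t.+2, 3) = t.+2 * (t.+1 * t))%N.
Proof. by rewrite mulnC -[6%N]/(3`!) bin_ffact !ffactSS ffactn1. Qed.

(** The least [r] with [m <= 'C(r, 3)] is written [t.+3]. Then
    [t (t+1) (t+2) < 6 m <= (t+1) (t+2) (t+3)], and [(t+1) (t+3) < (t+2)^2]. *)
Lemma ESO_bin (R : realType) m : (0 < m)%N ->
  exists t, [/\ (t ^ 3 < 6 * m)%N, (6 * m < t.+2 ^ 3)%N &
    (m + t <= ESO R m 3 <= m + t.+3)%N].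
Proof.
move=> m0; have E : exists r, (m <= 'C(r, 3))%N.
  exists m.+2; elim: (m) => // k IH; rewrite binS.
  by apply: leq_ltn_trans IH _; rewrite -[X in (X < _)%N]addn0 ltn_add2l bin_gt0.
case: (ex_minnP E) => r mr rmin.
have r3 : (3 <= r)%N by rewrite -bin_gt0 (leq_trans m0).
case: r r3 mr rmin => [|[|[|t]]] // _ mt tmin; exists t.
have tm : ('C(t.+2, 3) < m)%N by rewrite ltnNge; apply/negP => /tmin; rewrite ltnn.
split.
- have := bin3E t; move: tm; rewrite !expnS expn0 muln1; nia.
- have := bin3E t.+1; move: mt; rewrite !expnS expn0 muln1; nia.
have := ESO_bounds (@not_forced_bin R m t tm) (@forced_bin R m t.+3 mt).
by move: m0; clear; lia.
Qed.

Theorem theorem3 (R : realType) :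
  (forall m : nat, (0 < m)%N ->
     m%:R + (6 * m%:R) `^ (3^-1) - 2 < (ESO R m 3)%:R :> R /\
     (ESO R m 3)%:R < m%:R + (6 * m%:R) `^ (3^-1) + 3 :> R) /\
  ((fun m : nat => (ESO R m 3)%:R : R^o) =
   (fun m : nat => m%:R + (6 * m%:R) `^ (3^-1)) +O_\oo (fun _ : nat => 1 : R^o)).
Proof.
have bounds m : (0 < m)%N ->
    m%:R + (6 * m%:R) `^ (3^-1) - 2 < (ESO R m 3)%:R :> R /\
    (ESO R m 3)%:R < m%:R + (6 * m%:R) `^ (3^-1) + 3 :> R.
  move=> m0; set c := (6 * m%:R : R) `^ (3^-1).
  have c0 : 0 <= c by exact: powR_ge0.
  have c3 : c ^+ 3 = (6 * m)%:R.
    rewrite -powR_mulrn // /c -powRrM mulVf ?pnatr_eq0 // powRr1 ?natrM //.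
  (* As [t < c < t + 2], the bound [m + t] exceeds [m + c - 2], and [m + t + 3] is less than
     [m + c + 3]. *)
  have [t [t1 t2 /andP[mE Em]]] := ESO_bin R m0.
  have tc : t%:R < c.
    by rewrite -(@ltr_pXn2r _ 3) ?nnegrE ?ler0n // c3 -natrX ltr_nat.
  have ct : c < t%:R + 2.
    by rewrite -natrD addn2 -(@ltr_pXn2r _ 3) ?nnegrE ?ler0n // c3 -natrX ltr_nat.
  have : (m + t)%:R <= (ESO R m 3)%:R :> R by rewrite ler_nat.
  have : (ESO R m 3)%:R <= (m + (t + 3))%:R :> R by rewrite ler_nat addn3.
  by rewrite !natrD; move: tc ct; clear; split; lra.
(* The error lies between -2 and 3, so every constant [k >= 3] will do. *)
split=> //; apply/eqaddOP; near=> k; near=> m.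
have m0 : (0 < m)%N by near: m; exact: nbhs_infty_gt.
have [lo hi] := bounds m m0.
have k3 : 3 <= k by near: k; exact: nbhs_pinfty_ge.
rewrite normr1 mulr1 /= (le_trans _ k3) // ler_norml.
move: lo hi; rewrite !fctE.
set c := (6 * m%:R) `^ (3^-1); set e := (ESO R m 3)%:R.
by clearbody c e; clear; lra.
Unshelve. all: by end_near. Qed.
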